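(* Let $L$ satisfy (a) and (b) of the context, and let $\Gamma$ and $\Lambda$ be compact subsets of $\mathbb{R}$. Then, given a supersolution $v$ and a subsolution $u$ (in the sense of the context) of the HJB equation $$\rho u(x)-\langle\nabla u(x),Ax\rangle-\langle\nabla u(x),-\mu x\rangle-\inf_{(\alpha,a)\in\Sigma\times\Gamma}\big(\beta\,\delta_0(\nabla u(x))\,a+\langle\nabla u(x),\alpha\rangle+L(x,\alpha,a)\big)=0,$$ we have $u(x)\le v(x)$ for every $x\in\mathcal H$. In particular, there exists at most one solution of the HJB equation.
   Context: **Spaces and operators.** Let $\bar s>0$, $\beta>0$, $\rho>0$, $\mu\in\mathbb{R}$. Let $\mathcal H=L^2(0,\bar s)$ (real-valued), with inner product $\langle\cdot,\cdot\rangle$ and norm $|\cdot|$; for $x\in\mathcal H$, $x[r]$ denotes the value at $r$. Let $D(A)=\{f\in H^1(0,\bar s): f(0)=0\}$, $Af=-\beta f'$; its adjoint is $D(A^* )=\{f\in H^1(0,\bar s): f(\bar s)=0\}$, $A^*f=\beta f'$. For $p\in D(A^* )$, $\delta_0(p)=p[0]$. Fix $\lambda\in(0,1)$ and let $B=(A^*-\lambda I)^{-1}(A-\lambda I)^{-1}$, a bounded positive self-adjoint operator on $\mathcal H$; put $|x|_B=\sqrt{\langle Bx,x\rangle}$. A function $v:\mathcal H\to\mathbb R$ is Lipschitz with respect to the $B$-norm if there is $C$ with $|v(x)-v(y)|\le C|x-y|_B$ for all $x,y\in\mathcal H$. **Control sets and $L$.** $\Gamma,\Lambda\subset\mathbb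 R$ are compact and nonempty, $\|\Gamma\|=\sup_{a\in\Gamma}|a|$, and $\Sigma=\{\gamma\in L^2(0,\bar s):\gamma \text{ takes values in }\Lambda\}$. $L:\mathcal H\times\Sigma\times\Gamma\to\mathbb R$ is uniformly continuous, and there is $C_L\ge0$ with: (a) $|L(x,\alpha,a)-L(y,\alpha,a)|\le C_L|x-y|_B$ for all $x,y\in\mathcal H$, $(\alpha,a)\in\Sigma\times\Gamma$; (b) $|L|\le C_L$. **Test functions.** A function $\phi$ is $B$-lower semicontinuous if $\liminf\phi(x_n)\ge\phi(x)$ whenever $x_n\rightharpoonup x$ weakly in $\mathcal H$ and $|B(x_n-x)|\to0$. $\phi\in test1$ means: $\phi\in C^1(\mathcal H)$, $\phi$ is $B$-lower semicontinuous, $\nabla\phi(x)\in D(A^* )$ for all $x\in\mathcal H$, and $A^*\nabla\phi:\mathcal H\to\mathcal H$ is continuous. $g\in test2$ means: $g\in C^2(\mathcal H)$ and $g(x)=g_0(|x|)$ for some nondecreasing $g_0:\mathbb R^+\to\mathbb R$. The quotient $g_0'(|x|)/|x|$ is understood at $x=0$ as its limit $g_0''(0)$. **Solutions.** Let $u\in C(\mathcal H)$ be bounded and Lipschitz with respect to the $B$-norm. * $u$ is a subsolution if for every $\phi\in test1$, $g\in test2$ and every local maximum point $x$ of $u-(\phi+g)$, $$\rho u(x)-\langle A^*\nabla\phi(x),x\rangle-\langle\nabla\phi(x)+\nabla g(x),-\mu x\rangle-\inf_{(\alpha,a)\in\Sigma\times\Gamma}\big(\beta\delta_0(\nabla\phi(x))a+\langle\nabla\phi(x)+\nabla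 g(x),\alpha\rangle+L(x,\alpha,a)\big)\le\frac{g_0'(|x|)}{|x|}\beta\frac{\|\Gamma\|^2}{2}.$$ * $u$ is a supersolution if for every $\phi\in test1$, $g\in test2$ and every local minimum point $x$ of $u+(\phi+g)$, $$\rho u(x)+\langle A^*\nabla\phi(x),x\rangle+\langle\nabla\phi(x)+\nabla g(x),-\mu x\rangle-\inf_{(\alpha,a)\in\Sigma\times\Gamma}\big(-\beta\delta_0(\nabla\phi(x))a-\langle\nabla\phi(x)+\nabla g(x),\alpha\rangle+L(x,\alpha,a)\big)\ge-\frac{g_0'(|x|)}{|x|}\beta\frac{\|\Gamma\|^2}{2}.$$ * $u$ is a solution if it is both a subsolution and a supersolution. *)

(* Defs.v *)
From HB Require Import structures.
From mathcomp Require Import all_boot all_order all_algebra.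
From mathcomp Require Import all_classical all_reals all_analysis.
From mathcomp Require Import measurable_realfun.

Set Implicit Arguments.
Unset Strict Implicit.
Unset Printing Implicit Defensive.
Import Order.TTheory GRing.Theory Num.Theory.
Import numFieldNormedType.Exports.

Local Open Scope ring_scope.
Local Open Scope classical_set_scope.
Local Open Scope quotient_scope.

(* Lebesgue measure restricted to ]0, s[, as a measure on the whole line:
   "almost everywhere" then only sees ]0, s[. *)
Section interval_measure.
Context {R : realType} (s : R).

Let mI : measurable (`]0, s[%classic : set (measurableTypeR R)).
Proof. exact: measurable_itv. Qed.

Definition leb : {measure set (measurableTypeR R) -> \bar R} :=
  mrestr (@lebesgue_measure R) mI.

End interval_measure.

Definition L2 {R : realType} (s : R) : Type := LspaceType2 (leb s).

(* The library provides L^p only as a set of almost-everywhere classes; here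
   L^2(0, s) receives its structure of normed module. *)
Section L2_normed_module.
Context {R : realType} (s : R).
Local Notation mu := (leb s).
Local Notation Fun := (LfunType mu (lee1n 2)).
Local Notation T := (measurableTypeR R).

HB.instance Definition _ := gen_eqMixin (L2 s).
HB.instance Definition _ := gen_choiceMixin (L2 s).

Definition L2fun (x : L2 s) : T -> R := repr (x : {mfun_ mu, T >-> T}).
Coercion L2fun : L2 >-> Funclass.

Let L2fun_mfun (x : L2 s) : measurable_fun setT (x : T -> R).
Proof. exact: (@measurable_funPT _ _ T T (repr (x : {mfun_ mu, T >-> T}))). Qed.

Lemma L2fun_Lfun (x : L2 s) : (x : T -> R) \in Lfun mu 2%:E.
Proof.
rewrite inE; apply/andP; split; rewrite inE; first exact: L2fun_mfun.
exact: (Lebesgue_finite (s := x)).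
Qed.

Definition L2rep (x : L2 s) : Fun := Lfun_Sub (lee1n 2) (L2fun_Lfun x).

Let Fun_mfunT (f : Fun) : measurable_fun setT ((f : T -> R) : T -> T).
Proof. exact: (measurable_funPT (f : {mfun T >-> R})). Qed.

Let Fun_mfun (f : Fun) : {mfun T >-> T} :=
  HB.pack ((f : T -> R) : T -> T) (isMeasurableFun.Build _ _ T T _ (Fun_mfunT f)).

Lemma ae_eq_Lnorm2 (f g : T -> R) : measurable_fun setT f ->
  measurable_fun setT g -> f = g %[ae mu] ->
  (Lnorm mu 2%:E (EFin \o f)) = (Lnorm mu 2%:E (EFin \o g)).
Proof.
move=> mf mg fg; rewrite unlock /Lnorm; congr (_ `^ _)%E.
have mp (h : T -> R) : measurable_fun setT h ->
    @measurable_fun _ _ T (\bar R) setT (fun x => (`|(EFin \o h) x| `^ 2)%E).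
  move=> mh; apply: (measurableT_comp (measurable_poweR _)) => //=.
  by apply: measurableT_comp => //; apply: measurableT_comp.
apply: ae_eq_integral => //; [exact: mp|exact: mp|].
by apply: filterS fg => x /= fgx xT; rewrite fgx.
Qed.

Let class_repr (f : Fun) :
  (repr (\pi_{mfun_ mu, T >-> T} (Fun_mfun f)) : T -> R) = f %[ae mu].
Proof.
by apply/asboolP; rewrite -[`[< _ >]]/(ae_eq_op mu _ (Fun_mfun f)) -eqmodE reprK.
Qed.

Let class_finite (f : Fun) : finite_norm mu 2%:E
  (repr (\pi_{mfun_ mu, T >-> T} (Fun_mfun f)) : T -> R).
Proof.
have mr : measurable_fun setT
    (repr (\pi_{mfun_ mu, T >-> T} (Fun_mfun f)) : T -> R).
  exact: (@measurable_funPT _ _ T T (repr _)).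
have mf : measurable_fun setT (f : T -> R) by exact: measurable_funPT.
rewrite /finite_norm (ae_eq_Lnorm2 mr mf (class_repr f)).
exact: Lfunction_finite.
Qed.

Definition L2class (f : Fun) : L2 s :=
  HB.pack_for (LspaceType mu (lee1n 2)) (\pi_{mfun_ mu, T >-> T} (Fun_mfun f))
    (isFinLebesgue.Build _ T R mu 2%:E (lee1n 2) _ (class_finite f)).

Lemma L2classK (f : Fun) : (L2class f : T -> R) = f %[ae mu].
Proof. exact: class_repr. Qed.

Lemma L2P (x y : L2 s) : x = y <-> (x : T -> R) = y %[ae mu].
Proof.
split=> [->|xy]; first exact: ae_eq_refl.
have : LebesgueSpace.sort x = LebesgueSpace.sort y.
  rewrite -[LHS]reprK -[RHS]reprK; apply/eqP; rewrite eqmodE.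
  exact/asboolP.
case: x y {xy} => [x [[xP]]] [y [[yP]]] /= xy.
by move: xP yP; rewrite xy => xP yP; rewrite (Prop_irrelevance xP yP).
Qed.

Let L2class_eq (f g : Fun) : (f : T -> R) = g %[ae mu] -> L2class f = L2class g.
Proof.
move=> fg; apply/L2P.
exact: ae_eq_trans (L2classK f) (ae_eq_trans fg (ae_eq_sym (L2classK g))).
Qed.

Let L2repK (x : L2 s) : L2class (L2rep x) = x.
Proof. by apply/L2P; exact: (L2classK (L2rep x)). Qed.

Definition L2zero : L2 s := L2class 0.
Definition L2add (x y : L2 s) : L2 s := L2class (L2rep x + L2rep y).
Definition L2opp (x : L2 s) : L2 s := L2class (- L2rep x).
Definition L2scale (a : R) (x : L2 s) : L2 s := L2class (a *: L2rep x).

Let L2addE f g : L2add (L2class f) (L2class g) = L2class (f + g).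
Proof.
apply: L2class_eq; move: (L2classK f) (L2classK g).
by apply: filterS2 => r fr gr rT; exact: (congr2 +%R (fr rT) (gr rT)).
Qed.

Let L2oppE f : L2opp (L2class f) = L2class (- f).
Proof.
apply: L2class_eq; move: (L2classK f).
by apply: filterS => r fr rT; exact: (congr1 -%R (fr rT)).
Qed.

Let L2scaleE a f : L2scale a (L2class f) = L2class (a *: f).
Proof.
apply: L2class_eq; move: (L2classK f).
by apply: filterS => r fr rT; exact: (congr1 ( *%R a) (fr rT)).
Qed.

Let L2addA : associative L2add.
Proof.
move=> x y z; rewrite -(L2repK x) -(L2repK y) -(L2repK z) !L2addE.
by rewrite addrA.
Qed.

Let L2addC : commutative L2add.
Proof. by move=> x y; rewrite /L2add addrC. Qed.

Let L2add0 : left_id L2zero L2add.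
Proof. by move=> x; rewrite -(L2repK x) L2addE add0r. Qed.

Let L2addN : left_inverse L2zero L2opp L2add.
Proof. by move=> x; rewrite -(L2repK x) L2oppE L2addE addNr. Qed.

HB.instance Definition _ :=
  GRing.isZmodule.Build (L2 s) L2addA L2addC L2add0 L2addN.

Let L2scaleA a b x : L2scale a (L2scale b x) = L2scale (a * b) x.
Proof. by rewrite -(L2repK x) !L2scaleE scalerA. Qed.

Let L2scale1 : left_id 1 L2scale.
Proof. by move=> x; rewrite -(L2repK x) L2scaleE scale1r. Qed.

Let L2scaleDr : right_distributive L2scale +%R.
Proof.
by move=> a x y; rewrite [LHS]L2scaleE [RHS]L2addE scalerDr.
Qed.

Let L2scaleDl x : {morph L2scale^~ x : a b / a + b}.
Proof.
by move=> a b; rewrite [RHS]L2addE -scalerDl.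
Qed.

HB.instance Definition _ := GRing.Zmodule_isLmodule.Build R (L2 s)
  L2scaleA L2scale1 L2scaleDr L2scaleDl.

Definition L2norm (x : L2 s) : R := fine (Lnorm mu 2%:E (EFin \o (x : T -> R))).

Let L2normE (f : Fun) : L2norm (L2class f) = fine (Lnorm mu 2%:E (EFin \o f)).
Proof.
by congr fine; apply: ae_eq_Lnorm2 (L2classK f); last exact: measurable_funPT.
Qed.

Let L2normD x y : L2norm (x + y) <= L2norm x + L2norm y.
Proof. by rewrite [x + y]/(L2add x y) L2normE; exact: ler_LnormD. Qed.

Let L2normZ a x : L2norm (a *: x) = `|a| * L2norm x.
Proof.
rewrite [a *: x]/(L2scale a x) L2normE.
by rewrite (LnormZ (L2rep x) a) -(finite_norm_fine (L2rep x)).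
Qed.

Let L2norm0_eq0 x : L2norm x = 0 -> x = 0.
Proof.
move=> /(fine_Lnormr_eq0 (f := L2rep x)) x0; apply/L2P.
apply: (ae_eq_trans x0); exact: ae_eq_sym (L2classK 0).
Qed.

HB.instance Definition _ := Lmodule_isNormed.Build R (L2 s)
  L2normD L2normZ L2norm0_eq0.

End L2_normed_module.

Section state_space.
Context {R : realType} {s : R}.
Implicit Types (x y f g p : L2 s) (r c : R).

Definition dot x y : R := \int[leb s]_r (x r * y r).

Lemma L2_norm_dot x : `|x| = Num.sqrt (dot x x).
Proof.
rewrite -[LHS]/(fine (Lnorm (leb s) 2%:E (EFin \o (x : R -> R)))) unlock.
rewrite fine_poweR powR12_sqrt; last first.
  by apply: fine_ge0; apply: integral_ge0 => r _; exact: poweR_ge0.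
congr (Num.sqrt (fine _)); apply: eq_integral => r _ /=.
by rewrite powR_mulrn// real_normK ?num_real// expr2.
Qed.

Definition weak_cvg (x_ : nat -> L2 s) x :=
  forall y, dot (x_ n) y @[n --> \oo] --> dot x y.

(* C^1 functions with compact support in ]0, s[; testing against C^infinity
   ones would define the same weak derivative. *)
Definition test_fun (psi : R -> R) :=
  [/\ forall r, derivable psi r 1, continuous (derive1 psi) &
      exists a b, [/\ 0 < a, b < s & forall r, psi r != 0 -> a <= r <= b]].

Definition is_weak_deriv f g := forall psi, test_fun psi ->
  \int[leb s]_r (f r * derive1 psi r) = - \int[leb s]_r (g r * psi r).

Definition H1 : set (L2 s) := [set f | exists g, is_weak_deriv f g].

Definition weak_deriv f : L2 s := get (is_weak_deriv f).

(* The value at r in [0, s] of a class of functions is that of its continuous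
   representative on [0, s]. *)
Definition has_value f r c := exists F : R -> R,
  [/\ {within `[0, s], continuous F}, {ae leb s, forall t, f t = F t} & F r = c].

Definition value_at f r : R := get (has_value f r).

End state_space.

(* y |-> T^-1 y for an operator T with domain D. *)
Definition op_inv {V : pointedType} (D : set V) (T : V -> V) (y : V) : V :=
  get [set x | D x /\ T x = y].

Section operators.
Context {R : realType} {s : R} (beta lam : R).
Implicit Types (x y f p : L2 s).

Definition domA : set (L2 s) := [set f | H1 f /\ has_value f 0 0].
Definition opA f : L2 s := - beta *: weak_deriv f.

Definition domAstar : set (L2 s) := [set f | H1 f /\ has_value f s 0].
Definition opAstar f : L2 s := beta *: weak_deriv f.

Definition delta0 p : R := value_at p 0.

Definition opB x : L2 s :=
  op_inv domAstar (fun f => opAstar f - lam *: f)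
    (op_inv domA (fun f => opA f - lam *: f) x).

Definition Bnorm x : R := Num.sqrt (dot (opB x) x).

Definition Blipschitz (v : L2 s -> R) :=
  exists C : R, forall x y, `|v x - v y| <= C * Bnorm (x - y).

Definition B_lsc (phi : L2 s -> R) := forall (x_ : nat -> L2 s) x,
  weak_cvg x_ x -> `|opB (x_ n - x)| @[n --> \oo] --> (0 : R) ->
  ((phi x)%:E <= limn_einf (fun n => (phi (x_ n))%:E))%E.

End operators.

Section test_functions.
Context {R : realType} {s : R} (beta lam : R).
Implicit Types (x h : L2 s) (phi g : L2 s -> R).

(* Riesz representative of the Fréchet differential. *)
Definition grad phi x : L2 s := get [set p | forall h, 'd phi x h = dot p h].

Definition C1 phi := (forall x, differentiable phi x) /\ continuous (grad phi).

(* The last clause is the continuity of x |-> 'd (grad g) x in operator norm. *)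
Definition C2 g := [/\ C1 g, forall x, differentiable (grad g) x &
  forall x (e : R), 0 < e -> \forall y \near x, forall h,
    `|'d (grad g) y h - 'd (grad g) x h| <= e * `|h|].

Definition test1 phi := [/\ C1 phi, B_lsc beta lam phi,
  forall x, domAstar (grad phi x) &
  continuous (fun x => opAstar beta (grad phi x))].

(* g0 stands for a function on the nonnegative half-line: its values elsewhere
   play no role, and on the half-line it is determined by g. *)
Definition test2 g (g0 : R -> R) := [/\ C2 g,
  {in Num.nneg &, {homo g0 : a b / a <= b}} & forall x, g x = g0 `|x|].

(* g0'(r) / r for r > 0, extended by its limit at r = 0. *)
Definition radial_quotient (g0 : R -> R) (r : R) : R :=
  if r == 0 then lim (derive1 g0 t / t @[t --> 0^'+]) else derive1 g0 r / r.

Definition local_max (w : L2 s -> R) x := \forall y \near x, w y <= w x.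
Definition local_min (w : L2 s -> R) x := \forall y \near x, w x <= w y.

End test_functions.

(* Elements of L^2 being classes, "with values in Lambda" is meant almost
   everywhere. *)
Definition controls {R : realType} (s : R) (Lambda : set R) : set (L2 s) :=
  [set gamma | {ae leb s, forall r, Lambda (gamma r)}].
Arguments controls {R} s Lambda.

Definition set_norm {R : realType} (Gamma : set R) : R :=
  sup [set `|a| | a in Gamma].

Section HJB.
Context {R : realType} (s beta rho mu lam : R) (Gamma Lambda : set R).
Context (L : L2 s * controls s Lambda * Gamma -> R).
Implicit Types (u v : L2 s -> R) (x : L2 s).

Definition admissible u :=
  [/\ continuous u, exists M, forall x, `|u x| <= M & Blipschitz beta lam u].

Definition subsolution u := admissible u /\
  forall phi g g0 x, test1 beta lam phi -> test2 g g0 ->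
    local_max (fun y => u y - (phi y + g y)) x ->
    rho * u x - dot (opAstar beta (grad phi x)) x
      - dot (grad phi x + grad g x) (- mu *: x)
      - inf [set beta * delta0 (grad phi x) * set_val c.2
                 + dot (grad phi x + grad g x) (set_val c.1)
                 + L (x, c.1, c.2)
            | c in [set: controls s Lambda * Gamma]]
    <= radial_quotient g0 `|x| * beta * (set_norm Gamma ^+ 2 / 2).

Definition supersolution u := admissible u /\
  forall phi g g0 x, test1 beta lam phi -> test2 g g0 ->
    local_min (fun y => u y + (phi y + g y)) x ->
    rho * u x + dot (opAstar beta (grad phi x)) x
      + dot (grad phi x + grad g x) (- mu *: x)
      - inf [set - beta * delta0 (grad phi x) * set_val c.2
                 - dot (grad phi x + grad g x) (set_val c.1)
                 + L (x, c.1, c.2)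
            | c in [set: controls s Lambda * Gamma]]
    >= - (radial_quotient g0 `|x|) * beta * (set_norm Gamma ^+ 2 / 2).

Definition solution u := subsolution u /\ supersolution u.

End HJB.

(* Main.v *)
Require Import Defs.
From HB Require Import structures.
From mathcomp Require Import all_boot all_order all_algebra.
From mathcomp Require Import all_classical all_reals all_analysis.
From mathcomp Require Import measurable_realfun ring lra.

(** The proof doubles the variables. If u is a subsolution and v a supersolution, let
    (x, y) be a maximum point of

      u x - v y - a / 2 * |x - y|_B ^ 2 - d / 2 * (|x| ^ 2 + |y| ^ 2).

    The first penalty is an admissible phi in each variable, with gradients p and - p for
    p = a B (x - y), and the second one an admissible g. Subtracting the inequalities that
    define u and v at x and y, the unbounded operator appears through
    a <A* B (x - y), x - y>, which is nonpositive because the shift semigroup contracts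
    the B-norm, and the boundary terms delta_0 cancel in the difference of the infima. What
    remains is of order a |x - y|_B ^ 2, |x - y|_B and d (1 + |x| ^ 2 + |y| ^ 2). Since u
    and v are Lipschitz for the B-norm, a |x - y|_B is bounded, so the first two are of
    order 1 / a; a small d makes the last one small for fixed a ([doubling_estimate],
    [comparison_principle]).

    The maximum is attained although bounded sets are not compact ([doubling_max]). The
    B-norm of x is the norm of the resolvent of A at x, and this resolvent is compact. An
    ultrafilter of near-maximizers is thus Cauchy for the B-norm, for which u and v are
    Lipschitz. As the penalties are quadratic, the midpoint of two near-maximizers which
    are close in the B-norm but not in norm would exceed the supremum
    ([doubling_midpoint]); so the ultrafilter is Cauchy in norm and converges.

    The operators are reached through the Volterra operator and its adjoint, which Fubini's
    theorem relates ([dot_volterra]) and which are accretive. By the lemma of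
    du Bois-Reymond ([weak_deriv0_const]) the domains of A and of its adjoint are the
    ranges of these two operators ([domAP], [domAstarP]). The resolvent equations become
    equations g + k V g = y with V bounded and accretive, solved by a contraction
    ([accretive_onto]), and the compactness of the resolvent comes from the Hoelder
    continuity of primitives ([volterra_compact]). *)

Set Implicit Arguments.
Unset Strict Implicit.
Unset Printing Implicit Defensive.
Import Order.TTheory GRing.Theory Num.Theory.
Import numFieldNormedType.Exports.
Local Open Scope ring_scope.
Local Open Scope classical_set_scope.

(** * The inner product of L^2(0, s) *)

Section almost_everywhere.
Context d (T : measurableType d) (R : realType) (mu : {measure set T -> \bar R}).
Implicit Types P Q : T -> Prop.

Lemma aeI P Q : {ae mu, forall r, P r} -> {ae mu, forall r, Q r} ->
  {ae mu, forall r, P r /\ Q r}.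
Proof. by apply: filterS2. Qed.

Lemma aeS P Q : {ae mu, forall r, P r} -> (forall r, P r -> Q r) ->
  {ae mu, forall r, Q r}.
Proof. by move=> aP PQ; apply: filterS aP. Qed.

End almost_everywhere.

Section L2_inner_product.
Context {R : realType} {s : R}.
Local Notation mu := (leb s).
Local Notation T := (measurableTypeR R).
Implicit Types (x y z : L2 s) (a : R).

Lemma L2_measurable x : measurable_fun setT (x : T -> R).
Proof. exact: (measurable_funPT (L2rep x : {mfun T >-> R})). Qed.

Lemma L2_mul_integrable x y :
  mu.-integrable setT (EFin \o (fun r => x r * y r)).
Proof. exact/Lfun1_integrable/Lfun2_mul_Lfun1/L2fun_Lfun/L2fun_Lfun. Qed.

Lemma L2addE x y : ((x + y : L2 s) : T -> R) = (fun r => x r + y r) %[ae mu].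
Proof. exact: (L2classK (L2rep x + L2rep y)). Qed.

Lemma L2zeroE : ((0 : L2 s) : T -> R) = cst 0 %[ae mu].
Proof. exact: (L2classK 0). Qed.

Lemma L2oppE x : ((- x : L2 s) : T -> R) = (fun r => - x r) %[ae mu].
Proof. exact: (L2classK (- L2rep x)). Qed.

Lemma L2scaleE a x : ((a *: x : L2 s) : T -> R) = (fun r => a * x r) %[ae mu].
Proof. exact: (L2classK (a *: L2rep x)). Qed.

Lemma ae_eq_Rintegral (f g : T -> R) : measurable_fun setT f ->
  measurable_fun setT g -> f = g %[ae mu] ->
  \int[mu]_r f r = \int[mu]_r g r.
Proof.
move=> mf mg fg; congr fine; apply: ae_eq_integral => //.
- exact/measurable_EFinP.
- exact/measurable_EFinP.
- by apply: filterS fg => r fgr _; rewrite fgr.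
Qed.

Lemma dotC x y : dot x y = dot y x.
Proof. by apply: eq_Rintegral => r _; rewrite mulrC. Qed.

Lemma dotDl x y z : dot (x + y) z = dot x z + dot y z.
Proof.
rewrite -RintegralD//; try exact: L2_mul_integrable.
apply: ae_eq_Rintegral.
- by apply: measurable_funM; exact: L2_measurable.
- by apply: measurable_funD; apply: measurable_funM; exact: L2_measurable.
- by apply: filterS (L2addE x y) => r -> // _; rewrite mulrDl.
Qed.

Lemma dotZl a x y : dot (a *: x) y = a * dot x y.
Proof.
rewrite -RintegralZl//; last exact: L2_mul_integrable.
apply: ae_eq_Rintegral.
- by apply: measurable_funM; exact: L2_measurable.
- by apply: measurable_funM => //; apply: measurable_funM; exact: L2_measurable.
- by apply: filterS (L2scaleE a x) => r -> // _; rewrite mulrA.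
Qed.

Lemma dotNl x y : dot (- x) y = - dot x y.
Proof. by rewrite -scaleN1r dotZl mulN1r. Qed.

Lemma dot0l y : dot 0 y = 0.
Proof. by rewrite -(scale0r 0) dotZl mul0r. Qed.

Lemma dotBl x y z : dot (x - y) z = dot x z - dot y z.
Proof. by rewrite dotDl dotNl. Qed.

Lemma dotDr x y z : dot x (y + z) = dot x y + dot x z.
Proof. by rewrite dotC dotDl !(dotC x). Qed.

Lemma dotZr a x y : dot x (a *: y) = a * dot x y.
Proof. by rewrite dotC dotZl (dotC x). Qed.

Lemma dotNr x y : dot x (- y) = - dot x y.
Proof. by rewrite dotC dotNl (dotC x). Qed.

Lemma dot0r x : dot x 0 = 0.
Proof. by rewrite dotC dot0l. Qed.

Lemma dotBr x y z : dot x (y - z) = dot x y - dot x z.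
Proof. by rewrite dotDr dotNr. Qed.

Lemma dotxx x : dot x x = `|x| ^+ 2.
Proof.
by rewrite L2_norm_dot sqr_sqrtr//; apply: Rintegral_ge0 => r _; rewrite -expr2 sqr_ge0.
Qed.

(** The triangle inequality, squared. *)
Lemma dot_le x y : dot x y <= `|x| * `|y|.
Proof.
have := ler_normD x y; rewrite -(ler_pXn2r (n := 2))// ?nnegrE// ?addr_ge0//.
rewrite -!dotxx dotDl !dotDr sqrrD -!dotxx (dotC y x); lra.
Qed.

Lemma normr_dot x y : `|dot x y| <= `|x| * `|y|.
Proof.
rewrite ler_norml dot_le andbT lerNl -dotNl (le_trans (dot_le _ _))//.
by rewrite normrN.
Qed.

Lemma dot_eq x y : (forall h, dot x h = dot y h) -> x = y.
Proof.
move=> xy; apply/eqP; rewrite -subr_eq0 -normr_eq0 -sqrf_eq0 -dotxx dotBl.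
by rewrite xy subrr.
Qed.

End L2_inner_product.

(** * Bounded functions, step functions and primitives *)

Lemma measurable_ler_fun d (X : measurableType d) (R : realType) (f g : X -> R) :
  measurable_fun setT f -> measurable_fun setT g ->
  measurable_fun setT (fun r => ((f r <= g r)%R : bool)%:R : R).
Proof.
move=> mf mg.
rewrite (_ : (fun r => _) = (fun r => if f r <= g r then 1 else 0)).
  by apply: measurable_fun_ifT => //; exact: measurable_fun_ler.
by apply/funext => r; case: ifP.
Qed.

Section measure_facts.
Context {R : realType} (s : R).
Local Notation mu := (leb s).
Local Notation T := (measurableTypeR R).

Lemma leb_itv_le (a b : R) : a <= b -> (mu `]a, b]%classic <= (b - a)%:E)%E.
Proof.
move=> ab; apply: (@le_trans _ _ (lebesgue_measure (`]a, b]%classic : set R))).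
  by apply: le_measure; rewrite ?inE//; apply: measurableI; exact: measurable_itv.
by rewrite lebesgue_measure_itv/= lte_fin; case: ifPn => // _; rewrite lee_fin subr_ge0.
Qed.

Lemma leb_itv (a b : R) : 0 <= a -> a <= b -> b <= s ->
  mu `]a, b[%classic = (b - a)%:E.
Proof.
move=> a0 ab bs; rewrite /leb /= /mrestr.
rewrite (_ : _ `&` _ = `]a, b[%classic); last first.
  apply/seteqP; split=> r /=; rewrite !in_itv/=; first by case.
  by move=> /andP[ar rb]; rewrite ar rb (le_lt_trans a0 ar) (lt_le_trans rb bs).
rewrite lebesgue_measure_itv/= lte_fin; case: ltP => // ba.
by rewrite (le_anti (introT andP (conj ab ba))) subrr.
Qed.

Lemma leb_setT : 0 <= s -> mu setT = s%:E.
Proof.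
move=> s0; rewrite /leb /= /mrestr setTI lebesgue_measure_itv/= lte_fin.
case: ltP => [_|s0']; first by rewrite oppr0 addr0.
by rewrite -(le_anti (introT andP (conj s0 s0'))).
Qed.

Lemma leb_lty : (mu setT < +oo)%E.
Proof.
rewrite /leb /= /mrestr setTI lebesgue_measure_itv/= lte_fin.
by case: ifP => _; [rewrite oppr0 addr0 ltry | exact: (ltry 0)].
Qed.

Lemma leb_singleton (a : R) : mu [set a] = 0%E.
Proof.
apply/eqP; rewrite eq_le measure_ge0 andbT -(@lebesgue_measure_set1 R a).
by apply: le_measure; rewrite ?inE//; apply: measurableI => //; exact: measurable_itv.
Qed.

Lemma ae_leb_in : {ae mu, forall r : T, 0 < r < s}.
Proof.
exists (~` `]0, s[%classic); split.
- by apply: measurableC; exact: measurable_itv.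
- by rewrite /leb /= /mrestr setICl measure0.
- by move=> r /=; rewrite in_itv.
Qed.

Let lty : (@lebesgue_measure R (`]0%R, s[%classic : set R) < +oo)%E.
Proof.
rewrite lebesgue_measure_itv/= lte_fin.
by case: ifP => _; [rewrite oppr0 addr0 ltry | exact: (ltry 0)].
Qed.

Let mI : measurable (`]0, s[%classic : set T).
Proof. exact: measurable_itv. Qed.

(** Fubini's theorem is stated for measures packed as sigma-finite ones; this is
    the measure [leb s] in such a packaging. *)
Definition flebesgue : {finite_measure set T -> \bar R} := mfrestr mI lty.

Lemma Lfun2P (f : T -> R) : measurable_fun setT f ->
  (\int[mu]_r ((f r) ^+ 2)%:E < +oo)%E -> f \in Lfun mu 2%:E.
Proof.
move=> mf fi; rewrite inE; apply/andP; split; rewrite inE//=.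
rewrite /finite_norm unlock /Lnorm/= poweR_lty//.
apply: le_lt_trans fi; rewrite le_eqVlt; apply/orP; left; apply/eqP.
by apply: eq_integral => r _ /=; rewrite powR_mulrn// real_normK ?num_real.
Qed.

Lemma Lfun2_bounded (f : T -> R) (M : R) : measurable_fun setT f ->
  (forall r, 0 < r < s -> `|f r| <= M) -> f \in Lfun mu 2%:E.
Proof.
move=> mf fM; apply: Lfun2P => //.
apply: (@le_lt_trans _ _ (\int[mu]_r (M ^+ 2)%:E)%E).
  apply: ae_ge0_le_integral => //.
  - by move=> r _; rewrite lee_fin sqr_ge0.
  - by apply/measurable_EFinP; exact: measurable_funX.
  - by move=> r _; rewrite lee_fin sqr_ge0.
apply: (aeS ae_leb_in) => r /fM frM _; rewrite lee_fin.
    rewrite -[leLHS]real_normK ?num_real// lerXn2r// nnegrE.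
    exact: le_trans frM.
rewrite integral_cst//; apply: lte_mul_pinfty; rewrite ?lee_fin ?sqr_ge0//.
exact: leb_lty.
Qed.

(** Total for convenience: functions that are not square integrable go to 0. *)
Definition toL2 (f : T -> R) : L2 s :=
  if pselect (f \in Lfun mu 2%:E) is left h then L2class (Lfun_Sub (lee1n 2) h)
  else 0.

Lemma toL2E f : f \in Lfun mu 2%:E -> (toL2 f : T -> R) = f %[ae mu].
Proof. by rewrite /toL2; case: pselect => // h _; exact: L2classK. Qed.

Lemma dot_toL2 x (f : T -> R) : measurable_fun setT f -> f \in Lfun mu 2%:E ->
  dot x (toL2 f) = \int[mu]_r (x r * f r).
Proof.
move=> mf fL; apply: ae_eq_Rintegral.
- by apply: measurable_funM; exact: L2_measurable.
- by apply: measurable_funM => //; exact: L2_measurable.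
- by apply: filterS (toL2E fL) => r -> // _.
Qed.

End measure_facts.

Section primitive.
Context {R : realType} {s : R}.
Local Notation mu := (leb s).
Local Notation T := (measurableTypeR R).
Implicit Types (x y : L2 s) (t : R).

(** Step functions turn primitives into inner products, so that linearity and
    Hoelder continuity of primitives come from the Hilbert space structure. *)
Definition step t : L2 s := toL2 s (\1_(`]-oo, t]%classic) : T -> R).

Lemma step_Lfun t : (\1_(`]-oo, t]%classic) : T -> R) \in Lfun mu 2%:E.
Proof.
apply: (@Lfun2_bounded _ _ _ 1); first by apply: measurable_indic; exact: measurable_itv.
by move=> r _; rewrite indicE; case: (_ \in _); rewrite ?normr0 ?normr1.
Qed.

Lemma stepE t : (step t : T -> R) = (fun r => ((r <= t)%R : bool)%:R) %[ae mu].
Proof.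
apply: ae_eq_trans (toL2E (step_Lfun t)) _.
by apply: aeW => r _; rewrite indicE mem_setE in_itv.
Qed.

Definition prim x t : R := dot x (step t).

(** The difference is the indicator of ]t, u], whose measure may be less than
    u - t because only the part inside ]0, s[ counts. *)
Lemma step_diff_norm t u : t <= u -> `|step u - step t| ^+ 2 <= u - t.
Proof.
move=> tu; rewrite -dotxx /dot.
rewrite (@ae_eq_Rintegral _ _ _ (\1_(`]t, u]%classic) : T -> R)).
- rewrite /Rintegral integral_indic// setIT; have := leb_itv_le s tu.
  have : (0 <= leb s `]t, u]%classic)%E by exact: measure_ge0.
  by case: (leb s _) => //= r; rewrite !lee_fin.
- by apply: measurable_funM; exact: L2_measurable.
- by apply: measurable_indic; exact: measurable_itv.
- move: (L2addE (step u) (- step t)) (L2oppE (step t)) (stepE t).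
  move=> h1 h2 h3; apply: filterS2 (filterI h1 (stepE u)) (filterI h2 h3).
  move=> r [-> // ->] // [-> // ->] // _.
  rewrite indicE mem_setE in_itv/=.
  case: (ltP t r) => tr; case: (leP r u) => ru /=; rewrite ?subrr ?mulr0 ?subr0 ?mulr1//.
  by move: (lt_le_trans ru (le_trans tr tu)); rewrite ltxx.
Qed.

Lemma prim_sub x t u : prim x u - prim x t = dot x (step u - step t).
Proof. by rewrite dotBr. Qed.

(** Cauchy-Schwarz against a difference of two step functions. *)
Lemma prim_holder x t u : `|prim x u - prim x t| <= `|x| * Num.sqrt `|u - t|.
Proof.
wlog tu : t u / t <= u.
  move=> h; case: (leP t u) => tu; first exact: h.
  by rewrite distrC (distrC u) h// ltW.
rewrite prim_sub (le_trans (normr_dot _ _))// ler_wpM2l//.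
rewrite -(ler_pXn2r (n := 2))// ?nnegrE// sqr_sqrtr//.
by rewrite (le_trans (step_diff_norm tu))// ler_norm.
Qed.

Lemma prim_continuous x : continuous (prim x).
Proof.
move=> t; apply/cvgrPdist_lt => e e0 /=.
have d0 : 0 < (e / (`|x| + 1)) ^+ 2 by rewrite exprn_gt0// divr_gt0// ltr_wpDl.
near=> u.
rewrite distrC (le_lt_trans (prim_holder _ _ _))//.
have ue : Num.sqrt `|u - t| < e / (`|x| + 1).
  rewrite -(ltr_pXn2r (n := 2))// ?nnegrE ?divr_ge0 ?addr_ge0// ?ltW//.
  rewrite sqr_sqrtr// distrC; near: u; exact: cvgr_dist_lt.
apply: (@le_lt_trans _ _ (`|x| * (e / (`|x| + 1)))).
  by rewrite ler_wpM2l// ltW.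
by rewrite mulrCA gtr_pMr// ltr_pdivrMr ?mul1r ?ltrDl// ltr_wpDl.
Unshelve. all: by end_near. Qed.

Lemma prim_measurable x : measurable_fun setT (prim x : T -> R).
Proof. apply: continuous_measurable_fun; exact: prim_continuous. Qed.

Lemma primDl x y t : prim (x + y) t = prim x t + prim y t.
Proof. exact: dotDl. Qed.

Lemma primZl a x t : prim (a *: x) t = a * prim x t.
Proof. exact: dotZl. Qed.

Lemma step_le0 t : t <= 0 -> step t = 0.
Proof.
move=> t0; apply/L2P; apply: ae_eq_trans (stepE t) _.
apply: ae_eq_trans (ae_eq_sym L2zeroE).
apply: filterS (ae_leb_in s) => r /andP[r0 _] _.
by rewrite leNgt (le_lt_trans t0 r0).
Qed.

Lemma prim0 x : prim x 0 = 0.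
Proof. by rewrite /prim step_le0// dot0r. Qed.

Lemma step_ge t : s <= t -> step t = step s.
Proof.
move=> st; apply/L2P; apply: ae_eq_trans (stepE t) _.
apply: ae_eq_trans (ae_eq_sym (stepE s)).
apply: filterS (ae_leb_in s) => r /andP[_ rs] _.
by rewrite (ltW rs) (le_trans (ltW rs) st).
Qed.

Lemma step_norm t : 0 <= s -> `|step t| ^+ 2 <= s.
Proof.
move=> s0; case: (leP t 0) => [/step_le0 ->|t0]; first by rewrite normr0 expr0n.
have h u : 0 <= u -> u <= s -> `|step u| ^+ 2 <= s.
  move=> u0 us; have := step_diff_norm u0; rewrite (step_le0 (lexx 0)) !subr0.
  by move=> /le_trans; exact.
case: (leP t s) => [|/ltW/step_ge ->]; first exact/h/ltW.
exact: h.
Qed.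

Lemma L2_integrable x : mu.-integrable setT (EFin \o x).
Proof.
apply/Lfun1_integrable; apply: Lfun_subset12; last exact: L2fun_Lfun.
by rewrite ge0_fin_numE ?measure_ge0//; exact: leb_lty.
Qed.

Lemma EFin_dot x y : (dot x y)%:E = (\int[mu]_r (x r * y r)%:E)%E.
Proof.
by rewrite fineK//; apply: integrable_fin_num => //; exact: L2_mul_integrable.
Qed.

Lemma primE x t : (prim x t)%:E = (\int[mu]_r (x r * ((r <= t)%R : bool)%:R)%:E)%E.
Proof.
rewrite EFin_dot; apply: ae_eq_integral => //.
- by apply/measurable_EFinP; apply: measurable_funM; exact: L2_measurable.
- apply/measurable_EFinP; apply: measurable_funM; first exact: L2_measurable.
  exact: measurable_ler_fun.
- by apply: filterS (stepE t) => r -> // _.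
Qed.

End primitive.

(** * The Volterra operator and its adjoint *)

Section volterra.
Context {R : realType} {s : R}.
Local Notation mu := (leb s).
Local Notation T := (measurableTypeR R).
Implicit Types (x y : L2 s) (t : R).

Local Notation fmu := (flebesgue s).

Let kern x y (p : T * T) : R := (x p.1 * y p.2) * ((p.1 <= p.2)%R : bool)%:R.

Let kern_measurable x y : measurable_fun setT (kern x y).
Proof.
apply: measurable_funM; last exact: measurable_ler_fun.
apply: measurable_funM.
  exact: measurableT_comp (L2_measurable x) measurable_fst.
exact: measurableT_comp (L2_measurable y) measurable_snd.
Qed.

Let tensor_integrable x y :
  (fmu \x fmu)%E.-integrable setT (fun p => (x p.1 * y p.2)%:E).
Proof.
apply/integrable12ltyP.
  apply/measurable_EFinP.
  apply: measurable_funM.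
    exact: measurableT_comp (L2_measurable x) measurable_fst.
  exact: measurableT_comp (L2_measurable y) measurable_snd.
have /integrableP[my yf] := L2_integrable y.
have /integrableP[mx xf] := L2_integrable x.
set c := (\int[mu]_r _)%E in yf.
have c0 : (0 <= c)%E by exact: integral_ge0.
rewrite (_ : (\int[_]_r _)%E = (\int[mu]_r (`|(x r)%:E| * c))%E); last first.
  apply: eq_integral => r _ /=; rewrite -ge0_integralZl//; last exact: measurableT_comp.
  by apply: eq_integral => t _; rewrite /= normrM EFinM.
rewrite ge0_integralZr//; last exact: measurableT_comp.
by rewrite lte_mul_pinfty// ?integral_ge0// ge0_fin_numE ?integral_ge0.
Qed.

Let kern_integrable x y : (fmu \x fmu)%E.-integrable setT (EFin \o kern x y).
Proof.
apply: le_integrable (tensor_integrable x y) => //.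
  by apply/measurable_EFinP; apply: kern_measurable.
move=> p _ /=; rewrite lee_fin /kern normrM ler_piMr//.
by case: (p.1 <= p.2)%R; rewrite ?normr0 ?normr1.
Qed.

Lemma primCE y t : (prim y s - prim y t)%:E =
  (\int[mu]_r (y r * ((t <= r)%R : bool)%:R)%:E)%E.
Proof.
rewrite -dotBr EFin_dot; apply: ae_eq_integral => //.
- by apply/measurable_EFinP; apply: measurable_funM; exact: L2_measurable.
- apply/measurable_EFinP; apply: measurable_funM; first exact: L2_measurable.
  exact: measurable_ler_fun.
- have tn : {ae mu, forall r : T, r <> t}.
    exists [set t]; split; [exact: measurable_set1|exact: leb_singleton|].
    by move=> r /= /contrapT.
  have h1 := aeI (L2addE (step s : L2 s) (- step t)) (L2oppE (step t : L2 s)).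
  have h2 := aeI tn (ae_leb_in s).
  apply: (aeS (aeI (aeI (aeI (stepE s) (stepE t)) h2) h1)).
  move=> r [[[e1 e2] [rt /andP[_ rs]]] [e3 e4]] _ /=.
  rewrite e3// e4// e1// e2// (ltW rs); congr EFin; congr (_ * _)%R.
  by case: (ltgtP (r : R) t) => [_|_|/rt//]; rewrite ?subr0 ?subrr.
Qed.

(** The inverse of the derivative with zero value at 0. *)
Definition volterra x : L2 s := toL2 s (prim x).

Hypothesis s_ge0 : 0 <= s.

Lemma prim_le x t : `|prim x t| <= Num.sqrt s * `|x|.
Proof.
rewrite (le_trans (normr_dot _ _))// mulrC ler_wpM2r//.
by rewrite -(ler_pXn2r (n := 2))// ?nnegrE// sqr_sqrtr// step_norm.
Qed.

Lemma prim_Lfun x : (prim x : T -> R) \in Lfun mu 2%:E.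
Proof. exact: Lfun2_bounded (@prim_measurable _ _ x) (fun r _ => prim_le x r). Qed.

Lemma volterraE x : (volterra x : T -> R) = prim x %[ae mu].
Proof. exact: toL2E (prim_Lfun x). Qed.

Lemma volterraD x y : volterra (x + y) = volterra x + volterra y.
Proof.
apply/L2P; apply: ae_eq_trans (volterraE _) _; apply: ae_eq_trans (ae_eq_sym (L2addE _ _)).
by apply: filterS2 (volterraE x) (volterraE y) => r -> // -> // _; rewrite primDl.
Qed.

Lemma volterraZ a x : volterra (a *: x) = a *: volterra x.
Proof.
apply/L2P; apply: ae_eq_trans (volterraE _) _.
apply: ae_eq_trans (ae_eq_sym (L2scaleE _ _)).
by apply: filterS (volterraE x) => r -> // _; rewrite primZl.
Qed.

(** The integral from t to s, that is, minus the inverse of the derivative with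
    zero value at s. *)
Definition covolterra x : L2 s := prim x s *: step s - volterra x.

Lemma covolterraE x : (covolterra x : T -> R) = (fun t => prim x s - prim x t) %[ae mu].
Proof.
have h1 := aeI (L2addE (prim x s *: step s) (- volterra x)) (L2oppE (volterra x)).
have h2 := aeI (volterraE x) (ae_leb_in s).
apply: (aeS (aeI (aeI (aeI (stepE s) (L2scaleE (prim x s) (step s))) h2) h1)).
move=> t [[[e1 e2] [e3 /andP[_ ts]]] [e4 e5]] _.
by rewrite e4// e5// e3// e2// e1// (ltW ts) mulr1.
Qed.

(** Both sides integrate x r * y t over the triangle r <= t, in the two orders
    allowed by Fubini's theorem. Every integration by parts below is an instance. *)
Lemma dot_volterra x y : dot (volterra x) y = dot x (covolterra y).
Proof.
have mul_int (z : L2 s) (b : T -> bool) : measurable_fun setT (fun r => (b r)%:R : R) ->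
    mu.-integrable setT (fun r => (z r * (b r)%:R)%:E).
  move=> mb; apply: le_integrable (L2_integrable z) => //.
    by apply/measurable_EFinP; apply: measurable_funM => //; exact: L2_measurable.
  move=> r _; rewrite lee_fin normrM ler_piMr//.
  by case: (b r); rewrite ?normr0 ?normr1.
have e1 : (dot (volterra x) y)%:E = (\int[fmu]_t \int[fmu]_r (kern x y (r, t))%:E)%E.
  rewrite EFin_dot; apply: ae_eq_integral => //.
  - by apply/measurable_EFinP; apply: measurable_funM; exact: L2_measurable.
  - exact: measurable_fubini_G (kern_integrable x y).
  - apply: filterS (volterraE x) => t -> // _; rewrite mulrC EFinM primE -integralZl//.
      by apply: eq_integral => r _; rewrite -EFinM /kern/= mulrA (mulrC (y t)).
    by apply: mul_int; exact: measurable_ler_fun.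
have e2 : (dot x (covolterra y))%:E = (\int[fmu]_r \int[fmu]_t (kern x y (r, t))%:E)%E.
  rewrite EFin_dot; apply: ae_eq_integral => //.
  - by apply/measurable_EFinP; apply: measurable_funM; exact: L2_measurable.
  - exact: measurable_fubini_F (kern_integrable x y).
  - apply: filterS (covolterraE y) => r -> // _; rewrite EFinM primCE -integralZl//.
      by apply: eq_integral => t _; rewrite -EFinM /kern/= mulrA.
    by apply: mul_int; exact: measurable_ler_fun.
by apply: EFin_inj; rewrite e1 e2 (Fubini (kern_integrable x y)).
Qed.

(** The Volterra operator and its adjoint add up to a rank one operator, whose
    quadratic form is the square of the integral over ]0, s[; hence both are accretive. *)
Lemma dot_volterra_diag x : dot (volterra x) x = prim x s ^+ 2 / 2.
Proof.
have := dot_volterra x x; rewrite dotBr dotZr -/(prim x s) (dotC x) => e.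
by apply: (mulIf (x := 2)); rewrite ?pnatr_eq0// divfK ?pnatr_eq0// mulrDr mulr1 {1}e expr2 subrK.
Qed.

Lemma dot_covolterra_diag x : dot (covolterra x) x = prim x s ^+ 2 / 2.
Proof. by rewrite dotC -dot_volterra dot_volterra_diag. Qed.

Lemma covolterraD x y : covolterra (x + y) = covolterra x + covolterra y.
Proof. by rewrite /covolterra volterraD primDl scalerDl opprD addrACA. Qed.

Lemma covolterraZ a x : covolterra (a *: x) = a *: covolterra x.
Proof. by rewrite /covolterra volterraZ primZl scalerBr scalerA. Qed.

Lemma sqnorm_le x y (z : L2 s) : {ae mu, forall r, x r ^+ 2 <= y r ^+ 2 + z r ^+ 2} ->
  `|x| ^+ 2 <= `|y| ^+ 2 + `|z| ^+ 2.
Proof.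
move=> xyz; rewrite -!dotxx -lee_fin EFinD !EFin_dot.
have mm (u : L2 s) : measurable_fun setT (fun r : T => (u r * u r)%:E).
  by apply/measurable_EFinP; apply: measurable_funM; exact: L2_measurable.
rewrite -ge0_integralD//.
- apply: ae_ge0_le_integral => //.
  + by move=> r _; rewrite lee_fin -expr2 sqr_ge0.
  + by move=> r _; rewrite -EFinD lee_fin -!expr2 addr_ge0// sqr_ge0.
  + exact: emeasurable_funD.
  + by apply: (aeS xyz) => r + _; rewrite -EFinD lee_fin -!expr2.
- by move=> r _; rewrite lee_fin -expr2 sqr_ge0.
- by move=> r _; rewrite lee_fin -expr2 sqr_ge0.
Qed.

Lemma norm_bounded x c : 0 <= c -> {ae mu, forall r, `|x r| <= c} ->
  `|x| <= c * Num.sqrt s.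
Proof.
move=> c0 xc; rewrite -(ler_pXn2r (n := 2))// ?nnegrE ?mulr_ge0 ?sqrtr_ge0//.
rewrite exprMn sqr_sqrtr// -lee_fin -dotxx EFin_dot.
apply: (@le_trans _ _ (\int[mu]_r (c ^+ 2)%:E)%E).
  apply: ae_ge0_le_integral => //.
  - by move=> r _; rewrite lee_fin -expr2 sqr_ge0.
  - by apply/measurable_EFinP; apply: measurable_funM; exact: L2_measurable.
  - by move=> r _; rewrite lee_fin sqr_ge0.
  - apply: (aeS xc) => r xrc _; rewrite lee_fin -expr2 -[leLHS]real_normK ?num_real//.
    by rewrite lerXn2r// ?nnegrE.
by rewrite integral_cst// leb_setT// -EFinM.
Qed.

Lemma norm_volterra x : `|volterra x| <= s * `|x|.
Proof.
have -> : s * `|x| = Num.sqrt s * `|x| * Num.sqrt s.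
  by rewrite mulrAC -expr2 sqr_sqrtr.
apply: norm_bounded.
  by rewrite mulr_ge0// sqrtr_ge0.
by apply: (aeS (volterraE x)) => r ->//; exact: prim_le.
Qed.

Lemma norm_covolterra x : `|covolterra x| <= s * `|x|.
Proof.
have [->|n0] := eqVneq (covolterra x) 0; first by rewrite normr0 mulr_ge0.
rewrite -normr_gt0 in n0.
rewrite -(ler_pM2l n0) -expr2 -dotxx -dot_volterra (le_trans (dot_le _ _))//.
by rewrite mulrA ler_wpM2r// mulrC norm_volterra.
Qed.

End volterra.

(** * Weak derivatives of primitives *)

Section lebesgue_bridge.
Context {R : realType} {s : R}.
Local Notation mu := (leb s).
Local Notation T := (measurableTypeR R).
Implicit Types (x y h : L2 s) (t : R).

Let mI : measurable (`]0, s[%classic : set T).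
Proof. exact: measurable_itv. Qed.

Let leb_setC : mu (~` `]0, s[%classic) = 0%E.
Proof. by rewrite /leb /= /mrestr setICl measure0. Qed.

Lemma leb_integralE (f : T -> \bar R) : mu.-integrable setT f ->
  (\int[mu]_r f r = \int[lebesgue_measure]_(r in `]0%R, s[) f r)%E.
Proof.
move=> fi; rewrite (negligible_integral (measurableC mI) measurableT fi leb_setC).
rewrite setDE setTI setCK; apply: eq_measure_integral => A mA AI.
by rewrite /leb /= /mrestr setIidl.
Qed.

Lemma leb_integrable (f : T -> \bar R) : mu.-integrable setT f ->
  lebesgue_measure.-integrable (`]0, s[%classic : set T) f.
Proof.
move=> /[dup] fi /integrableP[mf fy]; apply/integrableP; split.
  exact: measurable_funTS.
rewrite -leb_integralE//; exact: integrable_abse.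
Qed.

Lemma ae_lebesgue_leb (P : T -> Prop) :
  {ae lebesgue_measure, forall r : T, P r} -> {ae mu, forall r, P r}.
Proof.
move=> [N [mN N0 PN]]; exists N; split => //.
apply/eqP; rewrite eq_le measure_ge0 andbT -N0.
by apply: le_measure; rewrite ?inE//; exact: measurableI.
Qed.

Lemma prim_lebesgue h t : prim h t =
  \int[lebesgue_measure]_(r in `]-oo, t]) ((h : R -> R) \_ `]0, s[) r.
Proof.
have mt : measurable (`]-oo, t]%classic : set T) by exact: measurable_itv.
apply: EFin_inj; rewrite primE.
rewrite (_ : (fun r => _) = (EFin \o h) \_ `]-oo, t]); last first.
  apply/funext => r; rewrite patchE mem_setE in_itv/=.
  by case: ifPn; rewrite ?mulr1 ?mulr0.
rewrite leb_integralE; last first.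
  apply/(integrable_restrict mu mt measurableT).
  by apply: integrableS (L2_integrable h) => //; rewrite setTI.
rewrite -integral_mkcondr setIC integral_mkcondr /Rintegral fineK.
  by apply: eq_integral => r _; rewrite !patchE; case: ifP.
apply: integrable_fin_num => //.
rewrite -[X in _.-integrable _ X]/(EFin \o ((h : T -> R) \_ `]0, s[)) -restrict_EFin.
apply/(integrable_restrict lebesgue_measure mI mt).
apply: integrableS (leb_integrable (L2_integrable h)) => //.
exact: measurableI.
Qed.

End lebesgue_bridge.

Section weak_derivative.
Context {R : realType} {s : R}.
Hypothesis s_gt0 : 0 < s.
Local Notation mu := (leb s).
Local Notation T := (measurableTypeR R).
Implicit Types (x y f g h : L2 s) (t : R).
Let s_ge0 := ltW s_gt0.

(** By Lebesgue's differentiation theorem a function is almost everywhere the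
    derivative of its primitive. *)
Lemma prim_eq0 h : (forall t, 0 <= t -> t <= s -> prim h t = 0) -> h = 0.
Proof.
move=> h0; have p0 t : prim h t = 0.
  case: (leP 0 t) => [t0|/ltW t0]; last by rewrite /prim step_le0// dot0r.
  case: (leP t s) => [|/ltW st]; first exact: h0.
  by rewrite /prim step_ge//; exact: h0.
have mI : measurable (`]0, s[%classic : set T) by exact: measurable_itv.
have hi := leb_integrable (L2_integrable h).
pose hr := (h : R -> R) \_ `]0, s[.
have := @FTC1Ny R hr.
have -> : (fun x : R => \int[lebesgue_measure]_(t in `]-oo, x]) hr t) = cst 0.
  by apply/funext => t; rewrite -prim_lebesgue p0.
move=> H; apply/L2P; apply: ae_eq_trans (ae_eq_sym L2zeroE).
have {}H := ae_lebesgue_leb (H _ _).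
apply: (aeS (aeI (ae_leb_in s) (H s _ _))).
- move=> y; rewrite -restrict_EFin.
  have my : measurable (`]-oo, y]%classic : set T) by exact: measurable_itv.
  apply/(integrable_restrict lebesgue_measure mI my).
  by apply: integrableS hi => //; exact: measurableI.
- exact: integrable_locally_restrict.
- move=> r [rs [_]] + _; rewrite derive1_cst /hr patchE mem_setE in_itv/= rs.
  by move=> <-.
Qed.

Lemma continuous_measurableT (f : R -> R) : continuous f ->
  measurable_fun setT (f : T -> R).
Proof. by move=> cf; apply: continuous_measurable_fun. Qed.

Lemma continuous_Lfun (f : R -> R) : continuous f -> (f : T -> R) \in Lfun mu 2%:E.
Proof.
move=> cf; have cK : compact (f @` `[0, s]).
  by apply: continuous_compact; [exact: continuous_subspaceT|exact: segment_compact].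
have [M [_ Mf]] := compact_bounded cK.
apply: (@Lfun2_bounded _ _ _ (M + 1)); first exact: continuous_measurableT.
move=> r /andP[r0 rs]; apply: (Mf (M + 1)); first by rewrite ltrDl.
by exists r => //=; rewrite in_itv/= (ltW r0) (ltW rs).
Qed.

Lemma dot_continuous x (f : R -> R) : continuous f ->
  dot x (toL2 s f) = \int[mu]_r (x r * f r).
Proof.
move=> cf; apply: dot_toL2; first exact: continuous_measurableT.
exact: continuous_Lfun.
Qed.

Lemma prim_toL2 (f : R -> R) t : continuous f -> 0 <= t -> t <= s ->
  prim (toL2 s f) t = \int[lebesgue_measure]_(r in `[0, t]) f r.
Proof.
move=> cf t0 ts; rewrite /prim dotC dot_continuous//.
have mt : measurable (`]0, t[%classic : set T) by exact: measurable_itv.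
have mf := continuous_measurableT cf.
rewrite (@ae_eq_Rintegral _ _ _ ((f : T -> R) \_ `]0, t[)); last 3 first.
- by apply: measurable_funM => //; exact: L2_measurable.
- by apply/(measurable_restrictT _ _).1 => //; exact: measurable_funTS.
- have tn : {ae mu, forall r : T, r <> t}.
    exists [set t]; split; [exact: measurable_set1|exact: leb_singleton|].
    by move=> r /= /contrapT.
  apply: (aeS (aeI (aeI (stepE t) tn) (ae_leb_in s))) => r [[er rt] /andP[r0 rs]] _.
  rewrite er// patchE mem_setE in_itv/= r0/= lt_neqAle.
  by move/eqP : rt => ->/=; case: (r <= t); rewrite ?mul1r ?mul0r.
rewrite -Rintegral_mkcond.
have ci : lebesgue_measure.-integrable `[0, t] (EFin \o (f : T -> R)).
  apply: (@continuous_compact_integrable R f); first exact: segment_compact.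
  exact: continuous_subspaceT.
rewrite -Rintegral_itv_obnd_cbnd; last first.
  by apply: integrableS ci => //; exact: subset_itv_oc_cc.
rewrite -Rintegral_itv_bndo_bndc; last first.
  by apply: integrableS ci => //; exact: subset_itv_oo_cc.
congr fine; apply: eq_measure_integral => A mA At.
rewrite /leb /= /mrestr setIidl//; apply: subset_trans At _ => r /=.
by rewrite !in_itv/= => /andP[-> /lt_le_trans]; apply.
Qed.

Lemma prim_derive1 (psi : R -> R) t : (forall r, derivable psi r 1) ->
  continuous (derive1 psi) -> 0 <= t -> t <= s ->
  prim (toL2 s (derive1 psi)) t = psi t - psi 0.
Proof.
move=> dpsi cpsi; rewrite le_eqVlt => /predU1P[<- _|t0 ts].
  by rewrite prim0 subrr.
rewrite (prim_toL2 cpsi (ltW t0) ts) /Rintegral.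
have cp : continuous psi by move=> r; apply/differentiable_continuous/derivable1_diffP.
have cw : {within `[0, t], continuous psi^`()} by exact: continuous_subspaceT.
have lr : derivable_oo_LRcontinuous psi 0 t.
  split; [by move=> r _; exact: dpsi|exact: cvg_at_right_filter (cp 0)|].
  exact: cvg_at_left_filter (cp t).
by rewrite (continuous_FTC2 t0 cw lr (fun _ _ => erefl)).
Qed.

Lemma test_fun_continuous psi : @test_fun R s psi -> continuous psi.
Proof. by case=> d _ _ r; apply/differentiable_continuous/derivable1_diffP. Qed.

Lemma test_fun_ends psi : @test_fun R s psi -> psi 0 = 0 /\ psi s = 0.
Proof.
case=> _ _ [a [b [a0 bs h]]]; split; apply/eqP; apply: contraTT isT => /h/andP[].
  by move=> /(lt_le_trans a0); rewrite ltxx.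
by move=> _ /le_lt_trans /(_ bs); rewrite ltxx.
Qed.

Lemma is_weak_derivP f g : is_weak_deriv f g <-> forall psi, @test_fun R s psi ->
  dot f (toL2 s (derive1 psi)) = - dot g (toL2 s psi).
Proof.
by split=> fg psi /[dup] tp /fg; rewrite !dot_continuous//;
  try exact: test_fun_continuous; case: tp.
Qed.

Lemma volterra_derive1 psi : @test_fun R s psi -> volterra (toL2 s (derive1 psi)) = toL2 s psi.
Proof.
move=> /[dup] tp /[dup] /test_fun_continuous cp [dp cdp _].
apply/L2P; apply: ae_eq_trans (volterraE s_ge0 _) _.
apply: ae_eq_trans (ae_eq_sym (toL2E (continuous_Lfun cp))).
apply: (aeS (ae_leb_in s)) => r /andP[r0 rs] _.
by rewrite (prim_derive1 dp cdp (ltW r0) (ltW rs)) (test_fun_ends tp).1 subr0.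
Qed.

(** The adjoint of the Volterra operator sends the derivative of a test function
    to minus that function, because the function vanishes at both ends. *)
Lemma is_weak_deriv_volterra g : is_weak_deriv (volterra g) g.
Proof.
apply/is_weak_derivP => psi tp; rewrite dot_volterra// /covolterra volterra_derive1//.
case: (tp) => dp cdp _; rewrite (prim_derive1 dp cdp s_ge0 (lexx s)).
by rewrite (test_fun_ends tp).1 (test_fun_ends tp).2 subrr scale0r sub0r dotNr.
Qed.

Lemma is_weak_deriv_step : is_weak_deriv (step s) (0 : L2 s).
Proof.
apply/is_weak_derivP => psi tp; case: (tp) => dp cdp _.
rewrite dotC -/(prim _ s) (prim_derive1 dp cdp s_ge0 (lexx s)).
by rewrite (test_fun_ends tp).1 (test_fun_ends tp).2 subrr dot0l oppr0.
Qed.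

Lemma is_weak_derivD f g f' g' : is_weak_deriv f g -> is_weak_deriv f' g' ->
  is_weak_deriv (f + f') (g + g').
Proof.
move=> /is_weak_derivP fg /is_weak_derivP fg'; apply/is_weak_derivP => psi tp.
by rewrite !dotDl fg// fg'// opprD.
Qed.

Lemma is_weak_derivZ a f g : is_weak_deriv f g -> is_weak_deriv (a *: f) (a *: g).
Proof.
move=> /is_weak_derivP fg; apply/is_weak_derivP => psi tp.
by rewrite !dotZl fg// mulrN.
Qed.

End weak_derivative.

(** * Functions with zero weak derivative *)

Section du_bois_reymond.
Context {R : realType} {s : R}.
Hypothesis s_gt0 : 0 < s.
Local Notation mu := (leb s).
Local Notation T := (measurableTypeR R).
Implicit Types (x y f g h : L2 s) (t : R).
Let s_ge0 := ltW s_gt0.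

(** Meant for 2 e <= b - a: ramps of width e at both ends of [a, b], and 1 in between. *)
Definition trapezoid (a b e t : R) : R :=
  Num.min 1 (Num.max 0 (Num.min (t - a) (b - t) / e)).

Lemma trapezoid_continuous (a b e : R) : continuous (trapezoid a b e).
Proof.
move=> t.
apply: (@continuous_min _ _ (cst 1) (fun t => Num.max 0 (Num.min (t - a) (b - t) / e))).
  exact: cvg_cst.
apply: (@continuous_max _ _ (cst 0) (fun t => Num.min (t - a) (b - t) / e)).
  exact: cvg_cst.
apply: cvgMl; apply: (@continuous_min _ _ (fun t => t - a) (fun t => b - t)).
  by apply: cvgB; [exact: cvg_id|exact: cvg_cst].
by apply: cvgB; [exact: cvg_cst|exact: cvg_id].
Qed.

Lemma trapezoid_eq0 (a b e t : R) : 0 < e -> Num.min (t - a) (b - t) <= 0 ->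
  trapezoid a b e t = 0.
Proof.
move=> e0 m0; rewrite /trapezoid [Num.max _ _]max_l; first by rewrite min_r.
by rewrite pmulr_lle0 ?invr_gt0.
Qed.

Lemma trapezoid_support (a b e t : R) : 0 < e -> trapezoid a b e t != 0 -> a <= t <= b.
Proof.
move=> e0; apply: contraR; rewrite negb_and -!ltNge => tab.
apply/eqP/trapezoid_eq0 => //; rewrite ge_min !subr_le0.
by case/orP: tab => /ltW ->; rewrite ?orbT.
Qed.

(** The two functions differ only on the two ramps, each of length e, and there by
    at most 1. *)
Lemma trapezoid_sqr_le (a b e r : R) : 0 < e -> a + e <= b - e ->
  (trapezoid a b e r - (((r <= b)%R : bool)%:R - ((r <= a)%R : bool)%:R)) ^+ 2 <=
  (((r <= a + e)%R : bool)%:R - ((r <= a)%R : bool)%:R) ^+ 2 +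
  (((r <= b)%R : bool)%:R - ((r <= b - e)%R : bool)%:R) ^+ 2.
Proof.
move=> e0 abe.
have T01 : 0 <= trapezoid a b e r <= 1.
  by rewrite /trapezoid ge_min lexx/= andbT le_min ler01/= le_max lexx.
have Ta : r <= a -> trapezoid a b e r = 0.
  by move=> ra; apply: trapezoid_eq0; rewrite // ge_min subr_le0 ra.
have Tb : b < r -> trapezoid a b e r = 0.
  by move=> rb; apply: trapezoid_eq0; rewrite // ge_min !subr_le0 (ltW rb) orbT.
have Tm : a + e < r -> r <= b - e -> trapezoid a b e r = 1.
  move=> r1 r2; rewrite /trapezoid min_l// le_max; apply/orP; right.
  by rewrite ler_pdivlMr// mul1r le_min; apply/andP; split; lra.
have Tsq : (trapezoid a b e r - 1) ^+ 2 <= 1.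
  by rewrite -sqrrN opprB expr_le1 ?subr_ge0 ?lerBlDr ?lerDl//; case/andP: T01.
case: (leP r a) => ra.
  have -> : r <= a + e by lra.
  have -> : r <= b - e by lra.
  have -> : r <= b by lra.
  by rewrite Ta//=; lra.
case: (leP r (a + e)) => rae.
  have -> : r <= b - e by lra.
  have -> : r <= b by lra.
  by rewrite /=; lra.
case: (leP r (b - e)) => rbe.
  have -> : r <= b by lra.
  by rewrite Tm//=; lra.
case: (leP r b) => rb /=; first by lra.
by rewrite Tb//=; lra.
Qed.

Lemma trapezoid_norm (a b e : R) : 0 < e -> a + e <= b - e ->
  `|toL2 s (trapezoid a b e) - (step b - step a)| ^+ 2 <= e *+ 2.
Proof.
move=> e0 abe; have cT := @trapezoid_continuous a b e.
set x := toL2 s _.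
apply: (@le_trans _ _ (`|step (a + e) - step a : L2 s| ^+ 2 +
  `|step b - step (b - e) : L2 s| ^+ 2)).
  apply: sqnorm_le.
  have h1 := aeI (L2addE x (- (step b - step a))) (L2oppE (step b - step a : L2 s)).
  have h2 := aeI (L2addE (step b : L2 s) (- step a)) (L2oppE (step a : L2 s)).
  have h3 := aeI (L2addE (step (a + e) : L2 s) (- step a))
    (L2addE (step b : L2 s) (- step (b - e))).
  have h4 := aeI (toL2E (continuous_Lfun cT)) (L2oppE (step (b - e) : L2 s)).
  have h5 := aeI (stepE (s := s) a) (stepE (s := s) b).
  have h6 := aeI (stepE (s := s) (a + e)) (stepE (s := s) (b - e)).
  apply: (aeS (aeI (aeI (aeI h1 h2) (aeI h3 h4)) (aeI h5 h6))).
  move=> r [[[[e1 e2] [e3 e4]] [[e5 e6] [e7 e8]]] [[e9 e10] [e11 e12]]].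
  rewrite e1// e2// e3// e5// e6// e4// e7// e8// e9// e10// e11// e12//.
  exact: trapezoid_sqr_le.
rewrite mulr2n lerD//.
  by apply: (le_trans (step_diff_norm _)); lra.
by apply: (le_trans (step_diff_norm _)); lra.
Qed.

(** Trapezoids approximate indicators of intervals in norm, so that orthogonality
    to them makes the primitive constant inside ]0, s[, hence zero by continuity. *)
Lemma dot_trapezoid_eq0 h : (forall a b e, 0 < a -> b < s -> 0 < e ->
    a + e <= b - e -> dot h (toL2 s (trapezoid a b e)) = 0) -> h = 0.
Proof.
move=> h0.
have pc a b : 0 < a -> a < b -> b < s -> prim h b = prim h a.
  move=> a0 ab bs; apply/eqP; rewrite -subr_eq0 -normr_le0.
  apply/ler_addgt0Pr => d d0; rewrite add0r.
  pose e := Num.min ((b - a) / 2) ((d / (`|h| + 1)) ^+ 2 / 2).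
  have hp : 0 < `|h| + 1 by rewrite ltr_wpDl.
  have e0 : 0 < e.
    by rewrite lt_min !divr_gt0 ?subr_gt0 ?exprn_gt0 ?divr_gt0.
  have e1 : a + e <= b - e.
    have : e <= (b - a) / 2 by rewrite ge_min lexx.
    lra.
  have e2 : e *+ 2 <= (d / (`|h| + 1)) ^+ 2.
    have : e <= (d / (`|h| + 1)) ^+ 2 / 2 by rewrite ge_min lexx orbT.
    lra.
  rewrite prim_sub -normrN -sub0r -(h0 a b e)// -dotBr (le_trans (normr_dot _ _))//.
  apply: (@le_trans _ _ (`|h| * (d / (`|h| + 1)))).
    have dp : 0 <= d / (`|h| + 1) by rewrite divr_ge0// ltW.
    rewrite ler_wpM2l// -(ler_pXn2r (n := 2))// ?nnegrE//.
    exact: le_trans (trapezoid_norm e0 e1) e2.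
  by rewrite mulrCA ger_pMr// ler_pdivrMr// mul1r lerDl.
have pin a : 0 < a -> a < s -> prim h a = 0.
  move=> a0 as_; apply/eqP; rewrite -normr_le0; apply/ler_addgt0Pr => d d0.
  have /cvgrPdist_lt/(_ _ d0) := @prim_continuous _ _ h 0.
  move=> /nbhs_ballP[r /= r0 /(_ (Num.min r a / 2))].
  have m0 : 0 < Num.min r a by rewrite lt_min r0.
  have mr : Num.min r a <= r by rewrite ge_min lexx.
  have ma : Num.min r a <= a by rewrite ge_min lexx orbT.
  rewrite prim0 sub0r normrN add0r => /(_ _)/ltW.
  rewrite (pc (Num.min r a / 2) a)//; [|lra|lra].
  apply; rewrite /ball /= sub0r normrN ger0_norm; lra.
apply: (prim_eq0 s_gt0) => t; rewrite le_eqVlt => /predU1P[<-|t0]; first by rewrite prim0.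
rewrite le_eqVlt => /predU1P[->|]; last exact: pin.
apply/eqP; rewrite -normr_le0; apply/ler_addgt0Pr => d d0.
have /cvgrPdist_lt/(_ _ d0) := @prim_continuous _ _ h s.
move=> /nbhs_ballP[r /= r0 /(_ (s - Num.min r s / 2))].
have m0 : 0 < Num.min r s by rewrite lt_min r0.
have mr : Num.min r s <= r by rewrite ge_min lexx.
have ma : Num.min r s <= s by rewrite ge_min lexx orbT.
rewrite (pin (s - Num.min r s / 2)) ?subr0 ?add0r; [|lra|lra].
move=> /(_ _)/ltW; apply; rewrite /ball /= opprB addrC subrK ger0_norm; lra.
Qed.

(** The primitive of eta vanishes to the left of the support, and also to the right
    because the mean is zero. *)
Lemma zero_mean_test_fun (eta : R -> R) a b : continuous eta -> 0 < a -> b < s ->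
  (forall r, eta r != 0 -> a <= r <= b) -> dot (step s) (toL2 s eta) = 0 ->
  exists2 psi, @test_fun R s psi & derive1 psi = eta.
Proof.
move=> ce a0 bs eab e0.
have mc : measurable (`[0, s]%classic : set T) by exact: measurable_itv.
have ci : lebesgue_measure.-integrable `[0, s] (EFin \o (eta : T -> R)).
  apply: (@continuous_compact_integrable R eta); first exact: segment_compact.
  exact: continuous_subspaceT.
have er : (eta : T -> R) \_ `[0, s] = eta.
  apply/funext => r; rewrite patchE mem_setE in_itv/=; case: ifPn => // /negP rs.
  apply/esym/eqP; apply: contraT => /eab rab; exfalso; apply: rs; lra.
pose psi t := \int[lebesgue_measure]_(r in `]-oo, t]) eta r.
have dpsi t : derivable psi t 1 /\ psi^`() t = eta t.
  apply: (@continuous_FTC1 R eta -oo%O t (t + 1)); rewrite ?ltrDl//.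
    have mt : measurable (`]-oo, t + 1]%classic : set T) by exact: measurable_itv.
    rewrite -er -restrict_EFin; apply/(integrable_restrict lebesgue_measure mc mt).
    by apply: integrableS ci => //; exact: measurableI.
  by rewrite ltNyr.
  exact: ce.
have dE : derive1 psi = eta by apply/funext => t; exact: (dpsi t).2.
exists psi => //; split; [by move=> r; exact: (dpsi r).1|by rewrite dE|].
exists a, b; split => // r; apply: contraR => /negP rab; apply/eqP.
case: (ltP r a) => ra.
  have mr : measurable (`]-oo, r]%classic : set T) by exact: measurable_itv.
  rewrite /psi (@eq_Rintegral _ _ _ _ _ (cst 0)) ?Rintegral_cst ?mul0r//.
  move=> t; rewrite inE/= in_itv/= => tr; apply/eqP; apply: contraT => /eab; lra.
rewrite -e0 dotC -/(prim _ s) prim_toL2 // /psi.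
rewrite Rintegral_mkcond [RHS]Rintegral_mkcond er; apply: eq_Rintegral => t _.
rewrite patchE mem_setE in_itv/=; case: ifPn => // /negP tr.
by apply/esym/eqP; apply: contraT => /eab tab; exfalso; apply: tr; lra.
Qed.

(** The lemma of du Bois-Reymond. Subtracting from a trapezoid the multiple of a
    fixed one that cancels its mean gives the derivative of a test function, so f is
    orthogonal to it; hence f minus a suitable constant is orthogonal to all trapezoids. *)
Lemma weak_deriv0_const f : is_weak_deriv f (0 : L2 s) -> exists c, f = c *: step s.
Proof.
move=> /is_weak_derivP f0.
have [[a0 [b0 [e0 [a00 b0s e00 _ m0]]]]|] :
    (exists a b e, [/\ 0 < a, b < s, 0 < e, a + e <= b - e &
      dot (step s) (toL2 s (trapezoid a b e)) != 0]) \/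
    ~ (exists a b e, [/\ 0 < a, b < s, 0 < e, a + e <= b - e &
      dot (step s) (toL2 s (trapezoid a b e)) != 0]) by exact: EM.
  pose t0 := toL2 s (trapezoid a0 b0 e0); pose m := dot (step s) t0.
  rewrite -/t0 -/m in m0.
  exists (dot f t0 / m); apply/eqP; rewrite -subr_eq0; apply/eqP.
  apply: dot_trapezoid_eq0 => a b e a_gt0 b_lts e_gt0 abe.
  set t := toL2 s _; set k := dot (step s) t.
  pose eta r := trapezoid a b e r - k / m * trapezoid a0 b0 e0 r.
  have ct := @trapezoid_continuous a b e.
  have ct0 := @trapezoid_continuous a0 b0 e0.
  have ce : continuous eta.
    by move=> r; apply: cvgB; [exact: ct|apply: cvgMr; exact: ct0].
  have etaE : toL2 s eta = t - (k / m) *: t0.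
    apply/L2P; apply: ae_eq_trans (toL2E (continuous_Lfun ce)) _.
    apply: (aeS (aeI (aeI (L2addE t (- ((k / m) *: t0))) (L2oppE ((k / m) *: t0)))
      (aeI (L2scaleE (k / m) t0)
        (aeI (toL2E (continuous_Lfun ct)) (toL2E (continuous_Lfun ct0)))))).
    by move=> r [[-> // ->] // [-> // [-> // -> //]]] _.
  have [||||psi tp psiE] := @zero_mean_test_fun eta (Num.min a a0) (Num.max b b0) ce.
  - by rewrite lt_min a_gt0.
  - by rewrite gt_max b_lts.
  - move=> r; rewrite ge_min le_max; apply: contraR.
    rewrite negb_and !negb_or => H; apply/eqP; rewrite /eta.
    have -> : trapezoid a b e r = 0.
      apply/eqP; apply: contraT => /(trapezoid_support e_gt0)/andP[ar rb].
      by move: H; rewrite ar rb.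
    have -> : trapezoid a0 b0 e0 r = 0.
      apply/eqP; apply: contraT => /(trapezoid_support e00)/andP[ar rb].
      by move: H; rewrite ar rb !andbF.
    by rewrite mulr0 subrr.
  - by rewrite etaE dotBr dotZr -/k -/m divfK// subrr.
  have := f0 psi tp; rewrite psiE etaE dotBr dotZr dot0l oppr0 => /eqP.
  rewrite subr_eq0 => /eqP ft.
  by rewrite dotBl dotZl -/k ft; field.
move=> H; have : (step s : L2 s) = 0.
  apply: dot_trapezoid_eq0 => a b e a_gt0 b_lts e_gt0 abe.
  by apply/eqP; apply: contrapT => n0; apply: H; exists a, b, e; split => //; apply/negP.
move=> i0; have id1 : derive1 (@id R) = cst 1.
  by apply/funext => r; rewrite derive1E derive_id.
have := @prim_derive1 R s id s (fun r => @derivable_id _ _ r 1).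
rewrite id1 /prim i0 dot0r subr0 => /(_ (fun r => cvg_cst _) s_ge0 (lexx s)) s0.
by have := lt_eqF s_gt0; rewrite s0 eqxx.
Qed.

End du_bois_reymond.

(** * The domains of the two generators *)

Section domains.
Context {R : realType} {s : R}.
Hypothesis s_gt0 : 0 < s.
Local Notation mu := (leb s).
Local Notation T := (measurableTypeR R).
Implicit Types (x y f g h : L2 s) (t : R).
Let s_ge0 := ltW s_gt0.

(** At a point where they differ, they differ on an interval of positive measure. *)
Lemma within_continuous_ae_eq (F G : R -> R) r :
  {within `[0, s], continuous F} -> {within `[0, s], continuous G} ->
  {ae mu, forall t : T, F t = G t} -> 0 <= r <= s -> F r = G r.
Proof.
move=> /subspace_continuousP cF /subspace_continuousP cG [N [mN N0 FGN]] rs.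
have rI : `[0, s]%classic r by rewrite /= in_itv.
have cFG : F t - G t @[t --> within `[0, s] (nbhs r)] --> F r - G r.
  by apply: cvgB; [exact: cF|exact: cG].
apply/eqP; rewrite -subr_eq0; apply: contraT => FGr.
have FGr0 : 0 < `|F r - G r| by rewrite normr_gt0.
move/cvgrPdist_lt : cFG => /(_ _ FGr0).
rewrite near_withinE => /nbhs_ballP[d /= d0 dFG].
pose a := Num.max 0 (r - d); pose b := Num.min s (r + d).
case/andP: rs => r0 rs.
have ab : a < b.
  rewrite /a /b lt_min !gt_max s_gt0/=.
  by apply/and3P; split; lra.
have a0 : 0 <= a by rewrite le_max lexx.
have bs : b <= s by rewrite ge_min lexx.
have : mu `]a, b[%classic = 0%E.
  apply/eqP; rewrite eq_le measure_ge0 andbT -N0.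
  have mab : measurable (`]a, b[%classic : set T) by exact: measurable_itv.
  apply: le_measure; rewrite ?inE//.
  move=> t /=; rewrite in_itv/= gt_max lt_min => /andP[/andP[t0 tr1] /andP[ts tr2]].
  apply: FGN => /= FGt.
  suff : `|(F r - G r) - (F t - G t)| < `|F r - G r|.
    by rewrite FGt subrr subr0 ltxx.
  apply: dFG; first by rewrite /ball/= ltr_norml; lra.
  by rewrite /= in_itv/= (ltW t0) (ltW ts).
rewrite leb_itv ?(ltW ab)// => -[] /eqP.
by rewrite subr_eq0 gt_eqF.
Qed.

Lemma has_value_uniq f r c c' : 0 <= r <= s ->
  has_value f r c -> has_value f r c' -> c = c'.
Proof.
move=> rs [F [cF fF <-]] [G [cG fG <-]].
apply: within_continuous_ae_eq => //.
by apply: (aeS (aeI fF fG)) => t [<- <-].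
Qed.

Lemma has_value_affine c g r : has_value (c *: step s + volterra g) r (c + prim g r).
Proof.
exists (fun t => c + prim g t); split=> //.
- apply: continuous_subspaceT => t; apply: cvgD; first exact: cvg_cst.
  exact: prim_continuous.
- apply: (aeS (aeI (aeI (L2addE (c *: step s) (volterra g)) (L2scaleE c (step s)))
     (aeI (aeI (stepE (s := s) s) (volterraE s_ge0 g)) (ae_leb_in s)))).
  move=> t [[-> // -> //] [[-> // -> //] /andP[_ ts]]].
  by rewrite (ltW ts) mulr1.
Qed.

Lemma has_value_volterra g r : has_value (volterra g) r (prim g r).
Proof. by have := has_value_affine 0 g r; rewrite scale0r !add0r. Qed.

Lemma covolterraE_affine g : covolterra g = prim g s *: step s + volterra (- g).
Proof. by rewrite -scaleN1r volterraZ// scaleN1r. Qed.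

Lemma has_value_covolterra g r : has_value (covolterra g) r (prim g s - prim g r).
Proof.
rewrite covolterraE_affine; have := has_value_affine (prim g s) (- g) r.
by rewrite -scaleN1r primZl mulN1r.
Qed.

Lemma weak_deriv_affine f g : is_weak_deriv f g -> exists c, f = c *: step s + volterra g.
Proof.
move=> fg; have [c fc] : exists c, f + (- 1) *: volterra g = c *: step s.
  apply: weak_deriv0_const => //; have := is_weak_derivZ (-1) (is_weak_deriv_volterra s_gt0 g).
  by move=> /(is_weak_derivD fg); rewrite (scaleN1r g) subrr.
by exists c; rewrite -fc scaleN1r subrK.
Qed.

(** Two weak derivatives have primitives that differ by a constant, which is zero
    since both primitives vanish at 0. *)
Lemma is_weak_deriv_uniq f g g' : is_weak_deriv f g -> is_weak_deriv f g' -> g = g'.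
Proof.
move=> /weak_deriv_affine[c fc] /weak_deriv_affine[c' fc'].
apply/eqP; rewrite -subr_eq0; apply/eqP.
have H r : 0 <= r <= s -> c + prim g r = c' + prim g' r.
  move=> rs; apply: (has_value_uniq (f := f) rs).
    by rewrite fc; exact: has_value_affine.
  by rewrite fc'; exact: has_value_affine.
have cc : c = c' by have := H 0; rewrite lexx s_ge0 !prim0 !addr0; apply.
apply: prim_eq0 => // t t0 ts; rewrite -scaleN1r primDl primZl mulN1r.
by apply/eqP; rewrite subr_eq0 -(inj_eq (addrI c)) {2}cc H// t0.
Qed.

Lemma weak_derivE f g : is_weak_deriv f g -> weak_deriv f = g.
Proof.
by move=> fg; apply: (is_weak_deriv_uniq (f := f)) => //; apply: getPex; exists g.
Qed.

Lemma weak_deriv_volterra g : weak_deriv (volterra g) = g.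
Proof. exact/weak_derivE/is_weak_deriv_volterra. Qed.

Lemma is_weak_deriv_covolterra g : is_weak_deriv (covolterra g) (- g).
Proof.
rewrite covolterraE_affine -[X in is_weak_deriv _ X]add0r; apply: is_weak_derivD.
  by rewrite -(scaler0 _ (prim g s)); apply: is_weak_derivZ; exact: is_weak_deriv_step.
exact: is_weak_deriv_volterra.
Qed.

Lemma weak_deriv_covolterra g : weak_deriv (covolterra g) = - g.
Proof. exact/weak_derivE/is_weak_deriv_covolterra. Qed.

(** A function with weak derivative g is a constant plus the primitive of g, and
    the value at 0 is the constant. *)
Lemma domAP f : domA f <-> exists g, f = volterra g.
Proof.
split=> [[[g fg] f0]|[g ->]].
  have [c fc] := weak_deriv_affine fg; exists g.
  have c0 : c = 0.
    have := has_value_affine c g 0; rewrite -fc prim0 addr0.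
    by move=> /(has_value_uniq _ f0) ->//; rewrite lexx.
  by rewrite fc c0 scale0r add0r.
split; first by exists g; exact: is_weak_deriv_volterra.
by have := has_value_volterra g 0; rewrite prim0.
Qed.

Lemma domAstarP f : domAstar f <-> exists g, f = covolterra g.
Proof.
split=> [[[g fg] fs]|[g ->]].
  have [c fc] := weak_deriv_affine fg; exists (- g).
  have c0 : c = - prim g s.
    have := has_value_affine c g s; rewrite -fc => /(has_value_uniq _ fs) c0.
    by apply/eqP; rewrite -addr_eq0 -c0// lexx s_ge0.
  by rewrite fc c0 covolterraE_affine opprK -[- g]scaleN1r primZl mulN1r.
split; first by exists (- g); exact: is_weak_deriv_covolterra.
by have := has_value_covolterra g s; rewrite subrr.
Qed.

(** Uniqueness of the continuous representative makes the value at 0 the one of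
    the integral from 0 to s. *)
Lemma delta0_covolterra g : delta0 (covolterra g) = prim g s.
Proof.
have h0 := has_value_covolterra g 0; rewrite prim0 subr0 in h0.
apply: (has_value_uniq (f := covolterra g) (r := 0)) => //; first by rewrite lexx.
by apply: getPex; exists (prim g s).
Qed.

Lemma opA_volterra beta g : opA beta (volterra g) = - beta *: g.
Proof. by rewrite /opA weak_deriv_volterra. Qed.

Lemma opAstar_covolterra beta g : opAstar beta (covolterra g) = - beta *: g.
Proof. by rewrite /opAstar weak_deriv_covolterra scalerN scaleNr. Qed.

End domains.

(** * Completeness of L^2(0, s) *)

Lemma limn_einf_le (R : realType) (u v : (\bar R)^nat) :
  (forall n, u n <= v n)%E -> (limn_einf u <= limn_einf v)%E.
Proof.
move=> uv; rewrite !limn_einf_lim; apply: lee_lim; [exact: is_cvg_einfs..|].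
apply: nearW => n; apply: le_ereal_inf_tmp => _ [k nk <-].
by apply: ge_ereal_inf; exists (u k) => //; exists k.
Qed.

Section riesz_fischer.
Context {R : realType} {s : R}.
Local Notation mu := (leb s).
Local Notation T := (measurableTypeR R).
Implicit Types (x y : L2 s).

Let mass : R := fine (mu setT).

Let mass_ge0 : 0 <= mass. Proof. exact: fine_ge0. Qed.

Let massE : mu setT = mass%:E.
Proof. by rewrite fineK// ge0_fin_numE//; exact: leb_lty. Qed.

Lemma integral_sqr_sub x y :
  (\int[mu]_r ((x r - y r) ^+ 2)%:E = (`|x - y| ^+ 2)%:E)%E.
Proof.
rewrite -dotxx EFin_dot; apply: ae_eq_integral => //.
- apply/measurable_EFinP; apply: measurable_funX; apply: measurable_funB;
    exact: L2_measurable.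
- by apply/measurable_EFinP; apply: measurable_funM; exact: L2_measurable.
- by apply: (aeS (aeI (L2addE x (- y)) (L2oppE y))) => r [-> // -> //] _; rewrite expr2.
Qed.

(** The inequality |r| <= c r^2 + 1/c, integrated. The parameter c is meant to
    balance the two terms. *)
Lemma integral_norm_sub x y (c : R) : 0 < c ->
  (\int[mu]_r `|x r - y r|%:E <= (c * `|x - y| ^+ 2 + mass / c)%:E)%E.
Proof.
move=> c0; have ci0 : 0 < c^-1 by rewrite invr_gt0.
have ms : measurable_fun setT (fun r : T => ((x r - y r) ^+ 2)%:E).
  apply/measurable_EFinP; apply: measurable_funX; apply: measurable_funB;
    exact: L2_measurable.
apply: (@le_trans _ _ (\int[mu]_r (c%:E * ((x r - y r) ^+ 2)%:E + (c^-1)%:E))%E).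
  apply: ge0_le_integral => //.
  - apply/measurable_EFinP; apply: measurableT_comp => //; apply: measurable_funB;
      exact: L2_measurable.
  - by apply: emeasurable_funD => //; exact: emeasurable_funM.
  - move=> r _; rewrite -EFinM -EFinD lee_fin.
    set a := x r - y r; have [a2 a0] : `|a| ^+ 2 = a ^+ 2 /\ 0 <= `|a|.
      by rewrite real_normK ?num_real.
    rewrite -a2 -(ler_pM2l c0) mulrDr divff ?gt_eqF//.
    have : 0 <= (c * `|a| - 1 / 2) ^+ 2 by exact: sqr_ge0.
    rewrite sqrrB; lra.
rewrite ge0_integralD//.
- rewrite ge0_integralZl//; last by rewrite lee_fin ltW.
    rewrite integral_sqr_sub integral_cst// massE -!EFinM -EFinD.
    by rewrite (mulrC c^-1).
  by move=> r _; rewrite lee_fin sqr_ge0.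
- by move=> r _; rewrite mule_ge0 ?lee_fin ?sqr_ge0 ?ltW.
- exact: emeasurable_funM.
- by move=> r _; rewrite lee_fin ltW.
Qed.

(** The Riesz-Fischer theorem for a geometric rate. The increments are summable in
    L^1, hence almost everywhere; the rate of convergence passes to the pointwise limit
    by Fatou's lemma. *)
Lemma L2_complete (x_ : nat -> L2 s) :
  (forall n m, (n <= m)%N -> `|x_ n - x_ m| <= 2^-1 ^+ n) ->
  exists x, forall n, `|x_ n - x| <= 2^-1 ^+ n.
Proof.
move=> xC.
pose d k (r : T) : \bar R := (`|x_ k.+1 r - x_ k r|)%:E.
have md k : measurable_fun setT (d k).
  apply/measurable_EFinP; apply: measurableT_comp => //; apply: measurable_funB;
    exact: L2_measurable.
have d0 k r : (0 <= d k r)%E by rewrite lee_fin.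
have intd k : (\int[mu]_r d k r <= ((1 + mass) * 2 / (2 ^ k.+1)%:R)%:E)%E.
  have c0 : 0 < (2 : R) ^+ k by rewrite exprn_gt0.
  apply: (le_trans (integral_norm_sub _ _ c0)).
  have := xC k k.+1 (leqnSn k); rewrite distrC -(ler_pXn2r (n := 2))// ?nnegrE ?exprn_ge0//.
  rewrite -(ler_pM2l c0).
  have -> : (2 : R) ^+ k * (2^-1 ^+ k) ^+ 2 = (2 ^+ k)^-1.
    by rewrite exprVn expr2 mulrA divff ?gt_eqF// mul1r.
  move=> h.
  rewrite lee_fin natrX (le_trans (lerD h (lexx _)))// exprS.
  rewrite -[X in X + _]mul1r -mulrDl -[2 * _]mulrC invfM mulrA.
  by rewrite (mulrAC (1 + mass)) mulfK.
have mG : measurable_fun setT (fun r => \sum_(k <oo) d k r)%E.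
  exact: ge0_emeasurable_sum.
have : mu.-integrable setT (fun r => \sum_(k <oo) d k r)%E.
  apply/integrableP; split => //.
  rewrite (eq_integral (fun r => \sum_(k <oo) d k r)%E); last first.
    by move=> r _; rewrite gee0_abs//; exact: nneseries_ge0.
  rewrite integral_nneseries//.
  apply: (@le_lt_trans _ _ ((1 + mass) * 2)%:E); last by rewrite ltry.
  have h : 0 <= (1 + mass) * 2 by rewrite mulr_ge0 ?addr_ge0.
  apply: (le_trans _ (epsilon_trick0 xpredT h)).
  by apply: lee_nneseries => [k _ _|k _]; [exact: integral_ge0|exact: intd].
move=> /(integrable_ae measurableT) Gfin.
pose g (r : T) : R := fine (limn_esup (fun n => (x_ n r)%:E)).
have mg : measurable_fun setT g.
  apply: (measurableT_comp (fine_measurable measurableT)).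
  apply: (@measurable_fun_limn_esup _ T R setT (fun n r => (x_ n r)%:E)) => n.
  by apply/measurable_EFinP; exact: (L2_measurable (x_ n)).
have gcvg : {ae mu, forall r, x_ n r @[n --> \oo] --> g r}.
  apply: (aeS Gfin) => r /(_ Logic.I) Gr.
  suff [l xl] : exists l : R, x_ n r @[n --> \oo] --> l.
    have : (x_ n r)%:E @[n --> \oo] --> l%:E by apply: cvg_EFin => //; exact: nearW.
    by move=> /cvg_limn_einf_sup[_ h]; rewrite /g h.
  have : cvgn [normed series (telescope (x_^~ r))].
    apply: nondecreasing_is_cvgn.
      by apply: nondecreasing_series => k _ _ /=.
    exists (fine (\sum_(k <oo) d k r)) => _ [n _ <-].
    rewrite -lee_fin fineK// /series/= -sumEFin.
    by apply: (nneseries_lim_ge n) => k _ _.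
  move=> /normed_cvg/cvg_ex[/= l sl]; exists (x_ 0%N r + l).
  under eq_fun do rewrite (eq_sum_telescope (x_^~ r)).
  by apply: cvgD => //; exact: cvg_cst.
have intg n : (\int[mu]_r ((x_ n r - g r) ^+ 2)%:E <= ((2^-1 ^+ n) ^+ 2)%:E)%E.
  (* The shift by n keeps all the indices in the range of the Cauchy estimate. *)
  pose f m (r : T) : \bar R := ((x_ n r - x_ (m + n)%N r) ^+ 2)%:E.
  have mf m : measurable_fun setT (f m).
    apply/measurable_EFinP; apply: measurable_funX; apply: measurable_funB;
      exact: L2_measurable.
  apply: (@le_trans _ _ (\int[mu]_r (limn_einf (f^~ r)))%E).
    rewrite le_eqVlt; apply/orP; left; apply/eqP; apply: ae_eq_integral => //.
    - by apply/measurable_EFinP; apply: measurable_funX; apply: measurable_funB => //;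
        exact: L2_measurable.
    - apply: measurableT_comp => //; apply: measurable_fun_limn_esup => m.
      exact: measurableT_comp.
    - apply: (aeS gcvg) => r gr _; apply/esym.
      apply: (cvg_limn_einf_sup _).1; apply: cvg_EFin; first exact: nearW.
      have gs : x_ (m + n)%N r @[m --> \oo] --> g r by rewrite (cvg_shiftn n (x_^~ r)).
      have gb : x_ n r - x_ (m + n)%N r @[m --> \oo] --> x_ n r - g r.
        by apply: cvgB => //; exact: cvg_cst.
      by rewrite /comp/= expr2; under eq_fun do rewrite expr2; exact: cvgM.
  apply: le_trans (fatou _ _ _ _) _ => //.
    by move=> m r _; rewrite lee_fin sqr_ge0.
  rewrite -[leRHS](cvg_limn_einf_sup (cvg_cst _)).1.
  apply: limn_einf_le => m; rewrite integral_sqr_sub lee_fin.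
  by rewrite lerXn2r ?nnegrE ?exprn_ge0// xC// leq_addl.
have mx n : measurable_fun setT (fun r : T => x_ n r - g r).
  by apply: measurable_funB => //; exact: L2_measurable.
have gL : (fun r : T => x_ 0%N r - g r) \in Lfun mu 2%:E.
  by apply: Lfun2P => //; rewrite (le_lt_trans (intg 0%N))// ltry.
pose z := toL2 s (fun r : T => x_ 0%N r - g r).
have xE : ((x_ 0%N - z : L2 s) : T -> R) = g %[ae mu].
  apply: (aeS (aeI (L2addE (x_ 0%N) (- z)) (aeI (L2oppE z) (toL2E gL)))).
  by move=> r [-> // [-> // -> //]] _; rewrite opprB addrC subrK.
exists (x_ 0%N - z) => n.
rewrite -(ler_pXn2r (n := 2))// ?nnegrE ?exprn_ge0// -lee_fin -integral_sqr_sub.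
apply: le_trans (intg n); rewrite le_eqVlt; apply/orP; left; apply/eqP.
apply: ae_eq_integral => //.
- apply/measurable_EFinP; apply: measurable_funX; apply: measurable_funB;
    exact: L2_measurable.
- by apply/measurable_EFinP; exact: measurable_funX.
- by apply: (aeS xE) => r ->.
Qed.

End riesz_fischer.

(** * Ultrafilters and accretive equations *)

(** A cluster point exists by compactness, and an ultrafilter converges to any of
    its cluster points. *)
Lemma ultra_bounded_cvg (R : realType) (X : Type) (F : set_system X) (f : X -> R)
  (M : R) : UltraFilter F -> F [set x | `|f x| <= M] ->
  exists l : R, f x @[x --> F] --> l.
Proof.
move=> UF FM; have cM : compact `[- M, M] by exact: segment_compact.
have FI : F (f @^-1` `[- M, M]).
  by apply: filterS FM => x /= fx; rewrite in_itv/= -ler_norml.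
have [p [_ pF]] := cM (f @ F) _ FI.
exists p => V Vp; have [//|FVc] := in_ultra_setVsetC (f @^-1` V) UF.
have [y [/= fVc Vy]] := pF (~` V) V FVc Vp.
by [].
Qed.

Section completeness.
Context {R : realType} {s : R}.

Lemma L2_cauchy_cvg (F : set_system (L2 s)) :
  ProperFilter F -> cauchy F -> cvg F.
Proof.
move=> FF /cauchyP FC.
have rad0 n : 0 < 2^-1 ^+ n.+2 :> R by rewrite exprn_gt0// invr_gt0.
have rad_le n m : (n <= m)%N -> 2^-1 ^+ m <= 2^-1 ^+ n :> R.
  by move=> nm; apply: ler_wiXn2l => //; rewrite ?invr_ge0// invf_le1// ler1n.
pose x_ n := xget 0 [set x | F (ball x (2^-1 ^+ n.+2))].
have xF n : F (ball (x_ n) (2^-1 ^+ n.+2)).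
  have [x xb] := FC _ (rad0 n).
  by rewrite /x_; case: xgetP => [y _ //|/(_ x)].
have [x xx] : exists x, forall n, `|x_ n - x| <= 2^-1 ^+ n.
  apply: L2_complete => n m nm.
  have [y [/=]] := filter_ex (filterI (xF n) (xF m)).
  rewrite -!ball_normE/= => yn ym.
  rewrite -(subrKA y) (le_trans (ler_normD _ _))// (distrC y).
  have := rad_le n.+2 m.+2; rewrite !ltnS => /(_ nm).
  have : (0 : R) < 2^-1 ^+ n by rewrite exprn_gt0// invr_gt0.
  rewrite !exprS in yn ym *; lra.
apply/cvg_ex; exists x; apply/cvg_ballP => e e0.
have [n ne] : exists n, 2^-1 ^+ n + 2^-1 ^+ n.+2 < e.
  have e4 : 0 < e / 2 by rewrite divr_gt0.
  have /cvgrPdist_lt/(_ _ e4)[n _ /(_ n (leqnn n))] :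
    (2^-1 : R) ^+ n @[n --> \oo] --> (0 : R).
    by apply: cvg_expr; rewrite ger0_norm ?invr_ge0// invf_lt1// ltr1n.
  rewrite /= sub0r normrN ger0_norm ?exprn_ge0 ?invr_ge0// => ne; exists n.
  have := rad_le n n.+2 (leqW (leqnSn n)); lra.
apply: filterS (xF n) => y; rewrite -!ball_normE/= => yn.
rewrite -(subrKA (x_ n)) (le_lt_trans (ler_normD _ _))// distrC.
by rewrite (lt_trans _ ne)// ler_ltD.
Qed.

HB.instance Definition _ := Uniform_isComplete.Build (L2 s) L2_cauchy_cvg.

(** A solution is a fixed point of x |-> x - th (x + k V x - y), and accretivity
    makes this map a contraction for a small relaxation factor th. *)
Lemma accretive_onto (V : L2 s -> L2 s) (K k : R) :
  {morph V : x y / x + y} -> (forall a, {morph V : x / a *: x}) ->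
  (forall x, `|V x| <= K * `|x|) -> (forall x, 0 <= dot (V x) x) -> 0 <= k ->
  forall y, exists g, g + k *: V g = y.
Proof.
move=> VD VZ VK V0 k0 y.
have VB u v : V (u - v) = V u - V v by rewrite VD -scaleN1r VZ scaleN1r.
pose c := (k * (`|K| + 1)) ^+ 2.
have c0 : 0 <= c by rewrite exprn_ge0// mulr_ge0// addr_ge0.
(* This value minimizes the squared Lipschitz constant (1 - th)^2 + th^2 c. *)
pose th := (1 + c)^-1.
have c1 : 0 < 1 + c by lra.
have th0 : 0 < th by rewrite invr_gt0.
have thE : th * (1 + c) = 1 by rewrite mulVf// gt_eqF.
pose q2 := (1 - th) ^+ 2 + th ^+ 2 * c.
have q20 : 0 <= q2.
  by apply: addr_ge0; [exact: sqr_ge0|apply: mulr_ge0 => //; exact: sqr_ge0].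
have q2E : q2 = 1 - th.
  rewrite /q2 sqrrB expr1n mul1r; have -> : th ^+ 2 * c = th * (th * (1 + c)) - th ^+ 2 by ring.
  rewrite thE; ring.
have q21 : q2 < 1 by rewrite q2E; lra.
pose f x := x - th *: (x + k *: V x - y).
have fC u v : `|f u - f v| <= Num.sqrt q2 * `|u - v|.
  set w := u - v.
  have -> : f u - f v = (1 - th) *: w - (th * k) *: V w.
    apply: dot_eq => h; rewrite /f /w VB !(dotBl, dotDl, dotZl); ring.
  rewrite -(ler_pXn2r (n := 2))// ?nnegrE ?mulr_ge0 ?sqrtr_ge0//.
  rewrite exprMn sqr_sqrtr// -dotxx dotBl !dotBr !dotZl !dotZr (dotC w (V w)) !dotxx.
  have Vw : `|V w| ^+ 2 <= (`|K| + 1) ^+ 2 * `|w| ^+ 2.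
    rewrite -exprMn lerXn2r// ?nnegrE ?mulr_ge0 ?addr_ge0// (le_trans (VK w))//.
    by rewrite ler_wpM2r//; have := ler_norm K; lra.
  have th1 : th <= 1 by rewrite invf_le1//; lra.
  have p1 : 0 <= (1 - th) * (th * k) * dot (V w) w.
    by rewrite !mulr_ge0 ?subr_ge0// ltW.
  have p2 : (th * k) ^+ 2 * `|V w| ^+ 2 <= (th * k) ^+ 2 * ((`|K| + 1) ^+ 2 * `|w| ^+ 2).
    by rewrite ler_wpM2l// sqr_ge0.
  have -> : q2 * `|w| ^+ 2 = (1 - th) ^+ 2 * `|w| ^+ 2 +
     (th * k) ^+ 2 * ((`|K| + 1) ^+ 2 * `|w| ^+ 2) by rewrite /q2 /c; ring.
  lra.
have sq : 0 <= Num.sqrt q2 by exact: sqrtr_ge0.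
have [||p _ pf] := @banach_fixed_point R (L2 s) setT (totalfun f) _ closedT.
- exists (NngNum sq); split => /=.
    by rewrite -(ltr_pXn2r (n := 2))// ?nnegrE// sqr_sqrtr// expr1n.
  by move=> -[u v] _ /=; exact: fC.
- by exists 0.
exists p; move: pf; rewrite /= /f => /eqP.
rewrite eq_sym -subr_eq0 addrAC subrr sub0r oppr_eq0 scaler_eq0 gt_eqF//=.
by rewrite subr_eq0 => /eqP.
Qed.

End completeness.

(** * Compactness and resolvents *)

Section compactness.
Context {R : realType} {s : R}.
Hypothesis s_gt0 : 0 < s.
Let s_ge0 := ltW s_gt0.

Lemma volterraB (x y : L2 s) : volterra (x - y) = volterra x - volterra y.
Proof. by rewrite volterraD// -scaleN1r volterraZ// scaleN1r. Qed.

Lemma primB (x y : L2 s) t : prim (x - y) t = prim x t - prim y t.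
Proof. by rewrite primDl -scaleN1r primZl mulN1r. Qed.

(** Primitives of a bounded family are equi-Hoelder, so that convergence on a fine
    finite grid controls them uniformly; on each grid point the bounded values converge
    along the ultrafilter. *)
Lemma volterra_compact (X : Type) (F : set_system X) (k : X -> L2 s) (M e : R) :
  UltraFilter F -> F [set x | `|k x| <= M] -> 0 < e ->
  exists2 A, F A & forall x y, A x -> A y -> `|volterra (k x) - volterra (k y)| <= e.
Proof.
move=> UF FM e0.
have M0 : 0 <= M.
  by have [x /= kx] := filter_ex FM; exact: le_trans kx.
have ss0 : 0 < Num.sqrt s by rewrite sqrtr_gt0.
pose d := e / (2 * Num.sqrt s).
have d0 : 0 < d by rewrite divr_gt0// mulr_gt0.
pose N := (Num.truncn (s * (2 * M / d) ^+ 2)).+1.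
have N0 : (0 : R) < N%:R by rewrite ltr0n.
have NE : s * (2 * M / d) ^+ 2 <= N%:R.
  have /truncn_itv/andP[_ /ltW] : 0 <= s * (2 * M / d) ^+ 2 by rewrite mulr_ge0// sqr_ge0.
  by [].
pose t_ (i : 'I_N.+1) : R := i%:R * (s / N%:R).
have /choice[l lP] : forall i, exists l : R, prim (k x) (t_ i) @[x --> F] --> l.
  move=> i; apply: (ultra_bounded_cvg (M := Num.sqrt s * M)).
  apply: filterS FM => x /= kx.
  by rewrite (le_trans (prim_le s_ge0 _ _))// ler_wpM2l// ltW.
have d2 : 0 < d / 2 by rewrite divr_gt0.
have FA : \forall x \near F, forall i, `|l i - prim (k x) (t_ i)| < d / 2.
  by apply: filter_forall => i; have /cvgrPdist_lt/(_ _ d2) := lP i.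
exists ([set x | `|k x| <= M] `&` [set x | forall i, `|l i - prim (k x) (t_ i)| < d / 2]).
  exact: filterI.
move=> x y [/= kxM kx] [/= kyM ky]; rewrite -volterraB.
have wM : `|k x - k y| <= 2 * M by rewrite (le_trans (ler_normB _ _))//; lra.
have -> : e = d * 2 * Num.sqrt s by rewrite /d; field; rewrite ?gt_eqF//.
apply: norm_bounded => //; first by rewrite mulr_ge0// ltW.
apply: (aeS (aeI (volterraE s_ge0 (k x - k y)) (ae_leb_in s))) => t [-> // /andP[t0 ts]].
have u0 : 0 <= t * N%:R / s by rewrite divr_ge0// mulr_ge0// ltW.
have iN : (Num.truncn (t * N%:R / s) < N.+1)%N.
  rewrite ltnS -(ler_nat R); have /andP[+ _] := truncn_itv u0.
  by move=> /le_trans; apply; rewrite ler_pdivrMr// mulrC ler_pM2l// ltW.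
pose i := Ordinal iN.
have ti : `|t - t_ i| <= s / N%:R.
  have /andP[i1 i2] := truncn_itv u0.
  have h : t = (t * N%:R / s) * (s / N%:R) by rewrite mulrA divfK ?gt_eqF// mulfK// gt_eqF.
  have sN : 0 < s / N%:R by rewrite divr_gt0.
  rewrite h /t_ /= -mulrBl normrM (gtr0_norm sN) ger_pMl// ger0_norm ?subr_ge0//.
  by rewrite -natr1 in i2; lra.
have tri : `|prim (k x - k y) (t_ i)| <= d.
  rewrite primB; have := kx i; have := ky i.
  set a := prim (k x) _; set b := prim (k y) _; set c := l i.
  rewrite !ltr_norml ler_norml => /andP[? ?] /andP[? ?]; apply/andP; split; lra.
have hol := prim_holder (k x - k y) (t_ i) t.
have hd : `|k x - k y| * Num.sqrt `|t - t_ i| <= d.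
  apply: (@le_trans _ _ (2 * M * Num.sqrt (s / N%:R))).
    by rewrite ler_pM// ?sqrtr_ge0// ler_wsqrtr.
  have m0 : 0 <= 2 * M * Num.sqrt (s / N%:R) by rewrite !mulr_ge0 ?sqrtr_ge0.
  have d0' := ltW d0; rewrite -(ler_pXn2r (n := 2))// exprMn sqr_sqrtr ?divr_ge0//.
  have : s * (2 * M) ^+ 2 <= d ^+ 2 * N%:R.
    have := NE; rewrite expr_div_n mulrA ler_pdivrMr ?exprn_gt0//.
    by rewrite [N%:R * _]mulrC.
  by move=> h; rewrite mulrA ler_pdivrMr// mulrC.
rewrite -[prim _ t](subrK (prim (k x - k y) (t_ i))).
by apply: (le_trans (ler_normD _ _)); lra.
Qed.

End compactness.

(** Both generators have as domain the range of an accretive Volterra operator [V],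
    which they invert up to the factor [- beta]. Their resolvents are therefore obtained
    together, by solving an equation for the preimage g under [V]. *)
Section resolvent.
Context {R : realType} {s : R} (beta lam : R).
Hypotheses (beta_gt0 : 0 < beta) (lam_gt0 : 0 < lam).
Variables (D : set (L2 s)) (A V : L2 s -> L2 s) (K : R).
Hypotheses (DP : forall f, D f <-> exists g, f = V g)
  (AV : forall g, A (V g) = - beta *: g)
  (VD : {morph V : x y / x + y}) (VZ : forall a, {morph V : x / a *: x})
  (VK : forall x, `|V x| <= K * `|x|) (V0 : forall x, 0 <= dot (V x) x).
Implicit Types (x y g : L2 s).

Local Notation res := (op_inv D (fun f => A f - lam *: f)).

Let preimage x : exists g, - beta *: g - lam *: V g = x.
Proof.
have kp : 0 <= lam / beta by rewrite divr_ge0// ltW.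
have [g gE] := accretive_onto VD VZ VK V0 kp (- beta^-1 *: x).
exists g; rewrite -[RHS]scale1r.
have -> : (1 : R) = - beta * - beta^-1 by rewrite mulrNN divff// gt_eqF.
rewrite -scalerA -gE scalerDr scalerA; congr (_ + _); rewrite -scaleNr; congr (_ *: _).
by field; rewrite gt_eqF.
Qed.

Let V_inj g g' :
  - beta *: g - lam *: V g = - beta *: g' - lam *: V g' -> V g = V g'.
Proof.
move=> gg; have VB : V (g - g') = V g - V g' by rewrite VD -scaleN1r VZ scaleN1r.
have : dot (- beta *: (g - g') - lam *: V (g - g')) (V (g - g')) = 0.
  rewrite [X in dot X _](_ : _ = 0) ?dot0l// VB.
  have := congr1 (fun z => z - (- beta *: g' - lam *: V g')) gg.
  rewrite subrr => <-; apply: dot_eq => h.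
  by rewrite !(dotBl, dotDl, dotZl, dotNl); ring.
rewrite dotBl !dotZl dotxx (dotC _ (V _)) => h0.
have h1 := mulr_ge0 (ltW beta_gt0) (V0 (g - g')).
have h2 : lam * `|V (g - g')| ^+ 2 = 0.
  by apply/eqP; rewrite eq_le mulr_ge0 ?sqr_ge0 ?(ltW lam_gt0)// andbT; lra.
move/eqP: h2; rewrite mulf_eq0 gt_eqF//= expf_eq0/= normr_eq0 VB subr_eq0.
by move/eqP.
Qed.

Lemma resolvent_spec x : D (res x) /\ A (res x) - lam *: res x = x.
Proof.
have [g gx] := preimage x; rewrite /op_inv.
by apply: (@getPex _ [set f | D f /\ A f - lam *: f = x]); exists (V g); split;
  [apply/DP; exists g|rewrite AV].
Qed.

Lemma resolventP x : exists2 g, res x = V g & x = - beta *: g - lam *: V g.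
Proof.
have [/DP[g gE] xE] := resolvent_spec x; exists g => //.
by rewrite -[LHS]xE gE AV.
Qed.

Lemma resolventE g : res (- beta *: g - lam *: V g) = V g.
Proof. by have [g' -> /V_inj ->] := resolventP (- beta *: g - lam *: V g). Qed.

Lemma resolventD : {morph res : x y / x + y}.
Proof.
move=> x y; have [g gE xE] := resolventP x; have [h hE yE] := resolventP y.
rewrite gE hE -VD -resolventE {1}xE {1}yE; congr (res _).
by rewrite VD; apply: dot_eq => k; rewrite !(dotBl, dotDl, dotZl, dotNl); ring.
Qed.

Lemma resolventZ a : {morph res : x / a *: x}.
Proof.
move=> x; have [g gE xE] := resolventP x.
rewrite gE -VZ -resolventE {1}xE; congr (res _).
by rewrite VZ; apply: dot_eq => k; rewrite !(dotBl, dotDl, dotZl, dotNl); ring.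
Qed.

(** Accretivity of [V] makes the generator dissipative. *)
Lemma dot_resolvent x : dot (res x) x <= - lam * `|res x| ^+ 2.
Proof.
have [g gE xE] := resolventP x; rewrite gE {1}xE dotBr !dotZr dotxx.
by have := mulr_ge0 (ltW beta_gt0) (V0 g); lra.
Qed.

Lemma norm_resolvent x : `|res x| <= lam^-1 * `|x|.
Proof.
have := dot_resolvent x; have := normr_dot (res x) x.
rewrite ler_norml => /andP[h1 _] h2.
have [->|n0] := eqVneq (res x) 0; first by rewrite normr0 mulr_ge0// invr_ge0 ltW.
rewrite -normr_gt0 in n0; rewrite ler_pdivlMl// -(ler_pM2l n0); lra.
Qed.

End resolvent.

(** * Quadratic test functions *)

Lemma lipschitz_continuous (R : realType) (V W : normedModType R) (f : V -> W) (K : R) :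
  (forall x y, `|f x - f y| <= K * `|x - y|) -> continuous f.
Proof.
move=> fK x; apply/cvgrPdist_lt => e e0.
have K0 : 0 < `|K| + 1 by rewrite ltr_wpDl.
near=> y.
apply: (@le_lt_trans _ _ ((`|K| + 1) * `|x - y|)).
  rewrite (le_trans (fK x y))// ler_wpM2r//.
  by have := ler_norm K; lra.
rewrite mulrC -ltr_pdivlMr//; near: y.
by apply: cvgr_dist_lt => //; rewrite divr_gt0.
Unshelve. all: by end_near. Qed.

Section quadratic.
Context {R : realType} {s : R}.
Implicit Types (x y h p : L2 s).

(** Inner products as bundled linear forms, the shape in which differentials are
    given. *)
Definition dotl p : L2 s -> R := dot p.

Lemma dotl_linear p : linear (dotl p).
Proof. by move=> a x y; rewrite /dotl dotDr dotZr. Qed.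

HB.instance Definition _ p := GRing.isLinear.Build R (L2 s) R _ (dotl p) (dotl_linear p).

Lemma dotl_continuous p : continuous (dotl p).
Proof.
apply: (@lipschitz_continuous _ _ _ _ `|p|) => x y.
by rewrite /dotl -dotBr normr_dot.
Qed.

Variables (V : L2 s -> L2 s) (K : R) (c : L2 s).
Hypotheses (VD : {morph V : x y / x + y}) (VZ : forall a, {morph V : x / a *: x})
  (VK : forall x, `|V x| <= K * `|x|) (Vsym : forall x y, dot (V x) y = dot x (V y))
  (V0 : forall x, 0 <= dot (V x) x).

Let VB x y : V (x - y) = V x - V y.
Proof. by rewrite VD -scaleN1r VZ scaleN1r. Qed.

Definition quadratic x := 2^-1 * dot (V (x - c)) (x - c).

Lemma quadratic_add x h :
  quadratic (x + h) = quadratic x + dot (V (x - c)) h + 2^-1 * dot (V h) h.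
Proof.
rewrite /quadratic addrAC; move: (x - c) => z.
by rewrite VD !(dotDl, dotDr) (Vsym h z) (dotC h (V z)); field.
Qed.

Lemma quadratic_diff x : differentiable quadratic x /\
  'd quadratic x = dotl (V (x - c)) :> (L2 s -> R).
Proof.
have E : quadratic \o shift x = cst (quadratic x) + dotl (V (x - c)) +o_ (0 : L2 s) id.
  apply/eqaddoP => e e0 /=.
  have K0 : 0 < `|K| + 1 by rewrite ltr_wpDl.
  near=> h; rewrite [X in `|X|](_ : _ = 2^-1 * dot (V h) h); last first.
    transitivity (quadratic (h + x) - (quadratic x + dot (V (x - c)) h)) => //.
    by rewrite (addrC h) quadratic_add; ring.
  rewrite normrM ger0_norm ?invr_ge0//.
  have h1 : `|dot (V h) h| <= (`|K| + 1) * `|h| * `|h|.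
    rewrite (le_trans (normr_dot _ _))// ler_wpM2r// (le_trans (VK h))// ler_wpM2r//.
    by have := ler_norm K; lra.
  have h2 : (`|K| + 1) * `|h| <= e.
    rewrite mulrC -ler_pdivlMr//; near: h.
    apply: filterS (@nbhs0_le _ (L2 s) (e / (`|K| + 1)) _) => //.
    by rewrite divr_gt0.
  have h3 : (`|K| + 1) * `|h| * `|h| <= e * `|h| by rewrite ler_wpM2r.
  have h4 : 0 <= `|dot (V h) h| by [].
  have := normr_ge0 (dot (V h) h); lra.
have dE : 'd quadratic x = dotl (V (x - c)) :> (L2 s -> R).
  by apply: diff_unique => //; exact: dotl_continuous.
split => //; apply/diff_locallyP; rewrite dE; split => //; exact: dotl_continuous.
Unshelve. all: by end_near. Qed.

Lemma grad_quadratic x : grad quadratic x = V (x - c).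
Proof.
have [_ dE] := quadratic_diff x.
have : [set p | forall h, 'd quadratic x h = dot p h] (grad quadratic x).
  by apply: getPex; exists (V (x - c)) => h; rewrite dE.
by move=> /= gE; apply: dot_eq => h; rewrite -gE dE.
Qed.

Lemma quadratic_C1 : C1 quadratic.
Proof.
split; first by move=> x; exact: (quadratic_diff x).1.
apply: (@lipschitz_continuous _ _ _ _ K) => x y; rewrite !grad_quadratic -VB.
by rewrite opprB addrA subrK VK.
Qed.

(** A convex function lies above its tangents, and the tangent at x is weakly
    continuous. *)
Lemma quadratic_lsc (x_ : nat -> L2 s) x : weak_cvg x_ x ->
  ((quadratic x)%:E <= limn_einf (fun n => (quadratic (x_ n))%:E))%E.
Proof.
move=> xx.
pose tangent n := quadratic x + (dot (x_ n) (V (x - c)) - dot x (V (x - c))).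
have tc : tangent n @[n --> \oo] --> quadratic x.
  rewrite -[X in _ --> X]addr0; apply: cvgD; first exact: cvg_cst.
  rewrite -(subrr (dot x (V (x - c)))); apply: cvgB; first exact: xx.
  exact: cvg_cst.
have : (tangent n)%:E @[n --> \oo] --> (quadratic x)%:E.
  by apply: cvg_EFin => //; exact: nearW.
move=> /cvg_limn_einf_sup[<- _]; apply: limn_einf_le => n; rewrite lee_fin /tangent.
rewrite -{2}(subrK x (x_ n)) addrC (addrC _ x) quadratic_add.
rewrite -dotBl dotC addrC lerDl mulr_ge0 ?invr_ge0//.
Qed.

End quadratic.

Section squared_norm.
Context {R : realType} {s : R}.
Variable (d : R).
Hypothesis d0 : 0 < d.
Implicit Types (x y h p : L2 s).

(** The scaling map as a function of the vector alone, to bundle it as linear. *)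
Definition scalel x : L2 s := d *: x.

Lemma scalel_linear : linear scalel.
Proof. by move=> a x y; rewrite /scalel scalerDr !scalerA mulrC. Qed.

HB.instance Definition _ :=
  GRing.isLinear.Build R (L2 s) (L2 s) _ scalel scalel_linear.

Definition sqnorm x : R := quadratic scalel 0 x.

Let scalel_sym x y : dot (scalel x) y = dot x (scalel y).
Proof. by rewrite dotZl dotZr. Qed.

Let scalel_norm x : `|scalel x| <= d * `|x|.
Proof. by rewrite normrZ gtr0_norm. Qed.

Let scalelD : {morph scalel : x y / x + y}.
Proof. by move=> x y; rewrite /scalel scalerDr. Qed.

Let scalelZ a : {morph scalel : x / a *: x}.
Proof. by move=> x; rewrite /scalel !scalerA mulrC. Qed.

Lemma sqnormE x : sqnorm x = d / 2 * `|x| ^+ 2.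
Proof. by rewrite /sqnorm /quadratic subr0 dotZl dotxx; field. Qed.

Lemma grad_sqnorm : grad sqnorm = scalel.
Proof.
by apply/funext => x; rewrite (grad_quadratic _ scalelD scalel_norm scalel_sym) subr0.
Qed.

Definition sqprofile (t : R) : R := d / 2 * t ^+ 2.

Lemma derive1_sqprofile t : derive1 sqprofile t = d * t.
Proof.
rewrite /sqprofile derive1E deriveZ//= exp_derive//=.
by rewrite expr1 !scaler1 /GRing.scale/=; field.
Qed.

Lemma radial_quotient_sqprofile r : 0 <= r -> radial_quotient sqprofile r = d.
Proof.
move=> r0; rewrite /radial_quotient; case: eqVneq => [_|n0]; last first.
  by rewrite derive1_sqprofile mulfK.
apply/cvg_lim => //.
apply: (@cvg_trans _ (cst d @ 0^'+)); last exact: cvg_cst.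
apply: near_eq_cvg; near=> t.
rewrite derive1_sqprofile mulfK// gt_eqF//; near: t; exact: nbhs_right_gt.
Unshelve. all: by end_near. Qed.

Lemma test2_sqnorm : test2 sqnorm sqprofile.
Proof.
have cl : continuous scalel.
  apply: (@lipschitz_continuous _ _ _ _ d) => x y.
  by rewrite /scalel -scalerBr normrZ gtr0_norm.
split.
- split.
  + exact: (quadratic_C1 0 scalelD scalelZ scalel_norm scalel_sym).
  + by move=> x; rewrite grad_sqnorm; exact: linear_differentiable.
  + move=> x e e0; apply: (@filterS _ (nbhs x) (nbhs_filter x) setT _ _ filterT).
    move=> y _ h; rewrite grad_sqnorm !diff_lin//.
    by rewrite subrr normr0 mulr_ge0// ltW.
- move=> a b; rewrite !nnegrE => a0 b0 ab; rewrite ler_pM2l ?divr_gt0//.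
  by rewrite lerXn2r.
- by move=> x; rewrite sqnormE.
Qed.

End squared_norm.

(** * The operator B and its norm *)

Section operator_B.
Context {R : realType} {s : R} (beta lam : R).
Hypotheses (s_gt0 : 0 < s) (beta_gt0 : 0 < beta) (lam_gt0 : 0 < lam).
Implicit Types (x y g p d : L2 s).
Let s_ge0 := ltW s_gt0.

Local Notation RA := (op_inv (@domA R s) (fun f => opA beta f - lam *: f)).
Local Notation RAs := (op_inv (@domAstar R s) (fun f => opAstar beta f - lam *: f)).
Local Notation B := (opB beta lam).

Let volterra_accr x : 0 <= dot (volterra x) x.
Proof. by rewrite dot_volterra_diag// divr_ge0// sqr_ge0. Qed.

Let covolterra_accr x : 0 <= dot (covolterra x) x.
Proof. by rewrite dot_covolterra_diag// divr_ge0// sqr_ge0. Qed.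

Let RA_D := resolventD beta_gt0 lam_gt0 (domAP s_gt0) (opA_volterra s_gt0 beta)
  (volterraD s_ge0) (volterraZ s_ge0) (norm_volterra s_ge0) volterra_accr.
Let RA_Z := resolventZ beta_gt0 lam_gt0 (domAP s_gt0) (opA_volterra s_gt0 beta)
  (volterraD s_ge0) (volterraZ s_ge0) (norm_volterra s_ge0) volterra_accr.
Let RA_P := resolventP beta_gt0 lam_gt0 (domAP s_gt0) (opA_volterra s_gt0 beta)
  (volterraD s_ge0) (volterraZ s_ge0) (norm_volterra s_ge0) volterra_accr.
Let RA_dot := dot_resolvent beta_gt0 lam_gt0 (domAP s_gt0) (opA_volterra s_gt0 beta)
  (volterraD s_ge0) (volterraZ s_ge0) (norm_volterra s_ge0) volterra_accr.
Let RA_norm := norm_resolvent beta_gt0 lam_gt0 (domAP s_gt0) (opA_volterra s_gt0 beta)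
  (volterraD s_ge0) (volterraZ s_ge0) (norm_volterra s_ge0) volterra_accr.
Let RAs_D := resolventD beta_gt0 lam_gt0 (domAstarP s_gt0) (opAstar_covolterra s_gt0 beta)
  (covolterraD s_ge0) (covolterraZ s_ge0) (norm_covolterra s_ge0) covolterra_accr.
Let RAs_Z := resolventZ beta_gt0 lam_gt0 (domAstarP s_gt0) (opAstar_covolterra s_gt0 beta)
  (covolterraD s_ge0) (covolterraZ s_ge0) (norm_covolterra s_ge0) covolterra_accr.
Let RAs_spec := resolvent_spec beta_gt0 lam_gt0 (domAstarP s_gt0) (opAstar_covolterra s_gt0 beta)
  (covolterraD s_ge0) (covolterraZ s_ge0) (norm_covolterra s_ge0) covolterra_accr.
Let RAs_P := resolventP beta_gt0 lam_gt0 (domAstarP s_gt0) (opAstar_covolterra s_gt0 beta)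
  (covolterraD s_ge0) (covolterraZ s_ge0) (norm_covolterra s_ge0) covolterra_accr.
Let RAs_norm := norm_resolvent beta_gt0 lam_gt0 (domAstarP s_gt0) (opAstar_covolterra s_gt0 beta)
  (covolterraD s_ge0) (covolterraZ s_ge0) (norm_covolterra s_ge0) covolterra_accr.

Lemma opBD : {morph (B : L2 s -> L2 s) : x y / x + y}.
Proof. by move=> x y; rewrite /opB RA_D RAs_D. Qed.

Lemma opBZ a : {morph (B : L2 s -> L2 s) : x / a *: x}.
Proof. by move=> x; rewrite /opB RA_Z RAs_Z. Qed.

Let RA_B x y : RA (x - y) = RA x - RA y.
Proof. by rewrite RA_D -scaleN1r RA_Z scaleN1r. Qed.

Lemma opBB x y : B (x - y) = B x - B y.
Proof. by rewrite opBD -scaleN1r opBZ scaleN1r. Qed.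

Lemma norm_opB x : `|B x| <= lam^-1 ^+ 2 * `|x|.
Proof.
by rewrite (le_trans (RAs_norm _))// expr2 -mulrA ler_wpM2l ?invr_ge0 ?(ltW lam_gt0).
Qed.

(** On preimages under the Volterra operators this is their adjunction. *)
Lemma resolvent_adjoint x y : dot (RA x) y = dot x (RAs y).
Proof.
have [g -> xE] := RA_P x; have [h -> yE] := RAs_P y.
have := dot_volterra s_ge0 g h; rewrite {1}yE {1}xE; move: (volterra g) (covolterra h) => u w e.
by rewrite !(dotBl, dotBr, dotZl, dotZr) e; ring.
Qed.

Lemma dot_opB x y : dot (B x) y = dot (RA x) (RA y).
Proof. by rewrite dotC -resolvent_adjoint dotC. Qed.

Lemma opB_sym x y : dot (B x) y = dot x (B y).
Proof. by rewrite dot_opB (dotC x) dot_opB dotC. Qed.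

(** The B-norm is the norm of the resolvent of A, which is how compactness and the
    bounds on this norm are reached. *)
Lemma BnormE x : Bnorm beta lam x = `|RA x|.
Proof. by rewrite /Bnorm dot_opB dotxx sqrtr_sqr normr_id. Qed.

Lemma opB_ge0 x : 0 <= dot (B x) x.
Proof. by rewrite dot_opB dotxx sqr_ge0. Qed.

Lemma Bnorm_ge0 x : 0 <= Bnorm beta lam x.
Proof. by rewrite BnormE. Qed.

Lemma Bnorm_sqr x : Bnorm beta lam x ^+ 2 = dot (B x) x.
Proof. by rewrite BnormE dot_opB dotxx. Qed.

Lemma Bnorm_sub x y : Bnorm beta lam (x - y) = Bnorm beta lam (y - x).
Proof. by rewrite !BnormE !RA_B distrC. Qed.

Lemma BnormZ a x : Bnorm beta lam (a *: x) = `|a| * Bnorm beta lam x.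
Proof. by rewrite !BnormE RA_Z normrZ. Qed.

Lemma Bnorm0 : Bnorm beta lam (0 : L2 s) = 0.
Proof. by rewrite -(scale0r 0) BnormZ normr0 mul0r. Qed.

Lemma Bnorm_continuous : continuous (Bnorm beta lam : L2 s -> R).
Proof.
apply: (@lipschitz_continuous _ _ _ _ lam^-1) => x y.
by rewrite !BnormE (le_trans (ler_dist_dist _ _))// -RA_B; exact: RA_norm.
Qed.

Lemma Bnorm_midpoint x y : Bnorm beta lam (2^-1 *: (x + y)) ^+ 2 =
  (Bnorm beta lam x ^+ 2 + Bnorm beta lam y ^+ 2) / 2
  - Bnorm beta lam (x - y) ^+ 2 / 4.
Proof.
rewrite !Bnorm_sqr opBZ opBD opBB dotZl dotZr !(dotDl, dotDr, dotNl, dotNr).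
by rewrite (opB_sym y x) (dotC y); field.
Qed.

Lemma opB_domAstar x : domAstar (B x).
Proof. exact: (RAs_spec (RA x)).1. Qed.

Lemma opAstar_opB x : opAstar beta (B x) = RA x + lam *: B x.
Proof. have e : opAstar beta (B x) - lam *: B x = RA x := (RAs_spec (RA x)).2.
by rewrite -e subrK. Qed.

(** With z the value at d of the resolvent of A, the left-hand side is <A z, z>, and
    A is dissipative. This sign disposes of the unbounded operator in the comparison. *)
Lemma dot_opAstar_opB d : dot (opAstar beta (B d)) d <= 0.
Proof.
rewrite opAstar_opB dotDl dotZl dot_opB dotxx.
by have := RA_dot d; lra.
Qed.

Lemma domAstarZ a p : domAstar p -> domAstar (a *: p).
Proof.
move=> /(domAstarP s_gt0)[g ->]; apply/(domAstarP s_gt0).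
by exists (a *: g); rewrite covolterraZ.
Qed.

Lemma opAstarZ a p : domAstar p -> opAstar beta (a *: p) = a *: opAstar beta p.
Proof.
move=> /(domAstarP s_gt0)[g ->].
by rewrite -covolterraZ// !opAstar_covolterra// !scalerA mulrC.
Qed.

(** The two test functions of the comparison have opposite gradients, whose values
    at 0 have to be opposite too. *)
Lemma delta0N p : domAstar p -> delta0 (- p) = - delta0 p.
Proof.
move=> /(domAstarP s_gt0)[g ->].
by rewrite -scaleN1r -covolterraZ// !delta0_covolterra// primZl mulN1r.
Qed.

Lemma B_compact (X : Type) (F : set_system X) (k : X -> L2 s) (M e : R) :
  UltraFilter F -> F [set i | `|k i| <= M] -> 0 < e ->
  exists2 A, F A & forall i j, A i -> A j -> Bnorm beta lam (k i - k j) <= e.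
Proof.
move=> UF FM e0.
pose G x := - beta^-1 *: (x + lam *: RA x).
have RAG x : RA x = volterra (G x).
  have [g gE xE] := RA_P x; rewrite gE /G gE {1}xE subrK scalerA mulrNN mulVf ?gt_eqF//.
  by rewrite scale1r.
have FG : F [set i | `|G (k i)| <= beta^-1 * (2 * M)].
  apply: filterS FM => x /= kx; rewrite /G normrZ normrN gtr0_norm ?invr_gt0//.
  rewrite ler_wpM2l ?invr_ge0 ?(ltW beta_gt0)// (le_trans (ler_normD _ _))//.
  have : lam * `|RA (k x)| <= `|k x|.
    by rewrite -ler_pdivlMl//; exact: RA_norm.
  rewrite normrZ (gtr0_norm lam_gt0); lra.
have [A FA AP] := volterra_compact s_gt0 UF FG e0.
exists A => // x y Ax Ay; rewrite BnormE RA_B !RAG; exact: AP.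
Qed.

Variables (a : R) (c : L2 s).
Hypothesis a_gt0 : 0 < a.

(** As a function of one variable, the penalization of the doubling. *)
Definition penalty := quadratic (fun x => a *: B x) c.

Lemma penaltyE x : penalty x = a / 2 * Bnorm beta lam (x - c) ^+ 2.
Proof. by rewrite /penalty /quadratic dotZl Bnorm_sqr; field. Qed.

Let VD : {morph (fun x => a *: B x) : x y / x + y}.
Proof. by move=> x y; rewrite opBD scalerDr. Qed.

Let VZ b : {morph (fun x => a *: B x) : x / b *: x}.
Proof. by move=> x; rewrite opBZ !scalerA mulrC. Qed.

Let VK x : `|a *: B x| <= a * lam^-1 ^+ 2 * `|x|.
Proof. by rewrite normrZ gtr0_norm// -mulrA ler_pM2l//; exact: norm_opB. Qed.

Let Vsym x y : dot (a *: B x) y = dot x (a *: B y).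
Proof. by rewrite dotZl dotZr opB_sym. Qed.

Let V0 x : 0 <= dot (a *: B x) x.
Proof. by rewrite dotZl mulr_ge0 ?opB_ge0// ltW. Qed.

Lemma grad_penalty x : grad penalty x = a *: B (x - c).
Proof. exact: (grad_quadratic c VD VK Vsym). Qed.

(** Its gradient is in the range of B, hence in the domain of the adjoint of A, and
    applying that adjoint to B x only leaves bounded operators. *)
Lemma test1_penalty : test1 beta lam penalty.
Proof.
split.
- exact: (quadratic_C1 c VD VZ VK Vsym).
- by move=> x_ x xx _; exact: (quadratic_lsc c VD Vsym V0).
- by move=> x; rewrite grad_penalty; apply: domAstarZ; exact: opB_domAstar.
- apply: (@lipschitz_continuous _ _ _ _ (a * (2 * lam^-1))) => x y.
  rewrite !grad_penalty !opAstarZ; [|exact: opB_domAstar..].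
  rewrite -scalerBr normrZ gtr0_norm// -mulrA ler_pM2l// !opAstar_opB.
  have -> : RA (x - c) + lam *: B (x - c) - (RA (y - c) + lam *: B (y - c))
      = RA (x - y) + lam *: B (x - y).
    rewrite !RA_B !opBB; apply: dot_eq => h.
    by rewrite !(dotBl, dotDl, dotZl, dotNl); ring.
  rewrite (le_trans (ler_normD _ _))// normrZ gtr0_norm//.
  have h1 := RA_norm (x - y).
  have h2 : lam * `|B (x - y)| <= lam^-1 * `|x - y|.
    have := norm_opB (x - y); rewrite -(ler_pM2l lam_gt0) => /le_trans; apply.
    by rewrite expr2 !mulrA divff ?gt_eqF// mul1r.
  lra.
Qed.

End operator_B.

(** * Maximum points of the doubled functional *)

Section maximum.
Context {R : realType} {s : R} (beta lam : R).
Hypotheses (s_gt0 : 0 < s) (beta_gt0 : 0 < beta) (lam_gt0 : 0 < lam).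
Implicit Types (x y : L2 s).
Local Notation "`[ x ]_B" := (Bnorm beta lam x) (at level 0, x at level 99).

Variables (u v : L2 s -> R) (M C a d : R).
Hypotheses (uM : forall x, `|u x| <= M) (vM : forall x, `|v x| <= M).
Hypotheses (uC : forall x y, `|u x - u y| <= C * `[x - y]_B)
  (vC : forall x y, `|v x - v y| <= C * `[x - y]_B).
Hypotheses (cu : continuous u) (cv : continuous v).
Hypotheses (C_ge0 : 0 <= C) (a_gt0 : 0 < a) (d_gt0 : 0 < d).

Definition doubling (z : L2 s * L2 s) : R := u z.1 - v z.2
  - a / 2 * `[z.1 - z.2]_B ^+ 2 - d / 2 * (`|z.1| ^+ 2 + `|z.2| ^+ 2).

Let norm_midpoint x y :
  `|2^-1 *: (x + y)| ^+ 2 = (`|x| ^+ 2 + `|y| ^+ 2) / 2 - `|x - y| ^+ 2 / 4.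
Proof.
rewrite -!dotxx !(dotZl, dotZr) !(dotDl, dotDr, dotNl, dotNr) (dotC y x).
by field.
Qed.

Let lip_midpoint (w : L2 s -> R) x y (e : R) :
  (forall x y, `|w x - w y| <= C * `[x - y]_B) -> `[x - y]_B <= e ->
  `|w (2^-1 *: (x + y)) - (w x + w y) / 2| <= C * e / 2.
Proof.
move=> wC xye; set m := 2^-1 *: (x + y).
have mx : m - x = 2^-1 *: (y - x).
  by apply: dot_eq => h; rewrite /m !(dotBl, dotZl, dotDl); field.
have my : m - y = 2^-1 *: (x - y).
  by apply: dot_eq => h; rewrite /m !(dotBl, dotZl, dotDl); field.
have h1 : `|w m - w x| <= C * e / 2.
  rewrite (le_trans (wC _ _))// mx BnormZ// ger0_norm ?invr_ge0// -mulrA ler_wpM2l//.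
  by rewrite mulrC ler_wpM2r ?invr_ge0// Bnorm_sub.
have h2 : `|w m - w y| <= C * e / 2.
  rewrite (le_trans (wC _ _))// my BnormZ// ger0_norm ?invr_ge0// -mulrA ler_wpM2l//.
  by rewrite mulrC ler_wpM2r ?invr_ge0.
move: h1 h2; rewrite !ler_norml => /andP[? ?] /andP[? ?]; apply/andP; split; lra.
Qed.

(** Both penalties are quadratic, hence gain by the parallelogram law, while u and
    v vary little between points that are close in the B-norm. *)
Lemma doubling_midpoint z z' e : `[z.1 - z'.1]_B <= e -> `[z.2 - z'.2]_B <= e ->
  (doubling z + doubling z') / 2 - C * e
    + d / 8 * (`|z.1 - z'.1| ^+ 2 + `|z.2 - z'.2| ^+ 2) <=
  doubling (2^-1 *: (z.1 + z'.1), 2^-1 *: (z.2 + z'.2)).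
Proof.
case: z z' => [x y] [x' y'] /= e1 e2; rewrite /doubling /=.
have E : 2^-1 *: (x + x') - 2^-1 *: (y + y') = 2^-1 *: ((x - y) + (x' - y')).
  by rewrite -scalerBr; congr (_ *: _); rewrite opprD addrACA.
rewrite E (norm_midpoint x x') (norm_midpoint y y').
rewrite (Bnorm_midpoint s_gt0 beta_gt0 lam_gt0 (x - y) (x' - y')).
have := lip_midpoint uC e1; have := lip_midpoint vC e2.
move: (u (_ *: _)) (v (_ *: _)) (u x) (u x') (v y) (v y') => um vm ux ux' vy vy'.
have : 0 <= a * `[x - y - (x' - y')]_B ^+ 2 by rewrite mulr_ge0 ?sqr_ge0 ?(ltW a_gt0).
move: (`[x - y - (x' - y')]_B ^+ 2) (`[x - y]_B ^+ 2) (`[x' - y']_B ^+ 2) => p q q'.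
move: (`|x - x'| ^+ 2) (`|y - y'| ^+ 2) (`|x| ^+ 2) (`|y| ^+ 2) (`|x'| ^+ 2) (`|y'| ^+ 2).
move=> n1 n2 n3 n4 n5 n6.
rewrite !ler_norml => h0 /andP[? ?] /andP[? ?]; lra.
Qed.

Let S := sup (range doubling).

Let doubling_le z : doubling z <= 2 * M - d / 2 * (`|z.1| ^+ 2 + `|z.2| ^+ 2).
Proof.
rewrite /doubling; have := uM z.1; have := vM z.2.
have : 0 <= a * `[z.1 - z.2]_B ^+ 2 by rewrite mulr_ge0 ?sqr_ge0 ?(ltW a_gt0).
rewrite !ler_norml => h0 /andP[? ?] /andP[? ?]; lra.
Qed.

Let has_supS : has_sup (range doubling).
Proof.
split; first by exists (doubling (0, 0)), (0, 0).
exists (2 * M) => _ [z _ <-]; rewrite (le_trans (doubling_le z))// gerBl.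
by rewrite mulr_ge0 ?divr_ge0 ?addr_ge0 ?sqr_ge0 ?(ltW d_gt0).
Qed.

Let doubling_leS z : doubling z <= S.
Proof. by apply: sup_upper_bound => //; exists z. Qed.

(** An ultrafilter of near-maximizers is Cauchy for the B-norm by compactness, and
    then Cauchy in norm: otherwise midpoints would exceed the supremum. *)
Lemma doubling_max : exists z0, forall z, doubling z <= doubling z0.
Proof.
pose F0 := filter_from [set e : R | 0 < e] (fun e => [set z | S - e < doubling z]).
have FF0 : ProperFilter F0.
  apply: filter_from_proper.
    apply: filter_from_filter; first by exists 1 => /=.
    move=> e e' /= e0 e0'; exists (Num.min e e') => /=; first by rewrite lt_min e0.
    move=> z /= zm; have h1 : Num.min e e' <= e by rewrite ge_min lexx.
    have h2 : Num.min e e' <= e' by rewrite ge_min lexx orbT.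
    by split; lra.
  move=> e /= e0; have [_ [z _ <-] ze] := sup_adherent e0 has_supS.
  by exists z.
have [F [UF F0F]] := ultraFilterLemma FF0.
have FS e : 0 < e -> F [set z | S - e < doubling z].
  by move=> e0; apply: F0F; exists e.
(* A bound on t^2 bounds t since t <= 1 + t^2. *)
pose r := 1 + 2 / d * (2 * M - S + 1).
have Fr : F [set z | `|z.1| <= r] /\ F [set z | `|z.2| <= r].
  have rP (t : R) : d / 2 * t ^+ 2 <= 2 * M - S + 1 -> t <= r.
    rewrite mulrC -ler_pdivlMr ?divr_gt0// invf_div mulrC => h.
    have : 0 <= (t - 1 / 2) ^+ 2 by exact: sqr_ge0.
    rewrite sqrrB /r; lra.
  have q0 x : 0 <= d / 2 * `|x| ^+ 2.
    by rewrite mulr_ge0 ?divr_ge0 ?sqr_ge0 ?(ltW d_gt0).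
  split; apply: filterS (FS 1 ltr01) => z /= zS; apply: rP;
    have := doubling_le z; have := q0 z.1; have := q0 z.2; lra.
have FC e : 0 < e -> exists2 A, F A & forall z z', A z -> A z' ->
    `|z.1 - z'.1| < e /\ `|z.2 - z'.2| < e.
  move=> e0; pose b := d * e ^+ 2 / 32.
  have b0 : 0 < b by rewrite divr_gt0// mulr_gt0// exprn_gt0.
  have bC0 : 0 < b / (C + 1) by rewrite divr_gt0// ltr_wpDl.
  have [A1 FA1 A1P] := B_compact s_gt0 beta_gt0 lam_gt0 UF Fr.1 bC0.
  have [A2 FA2 A2P] := B_compact s_gt0 beta_gt0 lam_gt0 UF Fr.2 bC0.
  exists ([set z | S - b < doubling z] `&` (A1 `&` A2)).
    by apply: filterI; [exact: FS|exact: filterI].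
  move=> z z' [/= zS [z1 z2]] [/= zS' [z1' z2']].
  have := doubling_midpoint (A1P _ _ z1 z1') (A2P _ _ z2 z2').
  move=> /le_trans/(_ (doubling_leS _)) h.
  have CB : C * (b / (C + 1)) <= b.
    by rewrite mulrCA ger_pMr// ler_pdivrMr ?ltr_wpDl// mul1r lerDl.
  have q1 := sqr_ge0 `|z.1 - z'.1|; have q2 := sqr_ge0 `|z.2 - z'.2|.
  have small : `|z.1 - z'.1| ^+ 2 + `|z.2 - z'.2| ^+ 2 < e ^+ 2.
    have : d / 8 * (`|z.1 - z'.1| ^+ 2 + `|z.2 - z'.2| ^+ 2) < 3 * b by lra.
    rewrite -ltr_pdivlMl ?divr_gt0// => /lt_le_trans; apply.
    have -> : (d / 8)^-1 * (3 * b) = 3 / 4 * e ^+ 2 by rewrite /b; field; rewrite gt_eqF.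
    by have := exprn_gt0 2 e0; lra.
  by split; rewrite -(ltr_pXn2r (n := 2))// ?nnegrE ?(ltW e0)//; lra.
have /cvg_ex[x Fx] : cvg ((fun z : L2 s * L2 s => z.1) @ F).
  apply: cauchy_cvg; apply: cauchy_exP => e e0; have [A FA AP] := FC _ e0.
  have [z Az] := filter_ex FA; exists z.1.
  apply: (@filterS _ F _ A) => // z' Az'.
  by rewrite /= -ball_normE/=; exact: (AP _ _ Az Az').1.
have /cvg_ex[y Fy] : cvg ((fun z : L2 s * L2 s => z.2) @ F).
  apply: cauchy_cvg; apply: cauchy_exP => e e0; have [A FA AP] := FC _ e0.
  have [z Az] := filter_ex FA; exists z.2.
  apply: (@filterS _ F _ A) => // z' Az'.
  by rewrite /= -ball_normE/=; exact: (AP _ _ Az Az').2.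
have Fxy : doubling z @[z --> F] --> doubling (x, y).
  apply: cvgB; first apply: cvgB; first apply: cvgB.
  - by apply: (cvg_comp _ _ Fx); exact: cu.
  - by apply: (cvg_comp _ _ Fy); exact: cv.
  - apply: cvgMr; rewrite expr2; under eq_fun do rewrite expr2.
    have h : `[z.1 - z.2]_B @[z --> F] --> `[x - y]_B.
      have h0 : z.1 - z.2 @[z --> F] --> x - y by exact: cvgB.
      by apply: (cvg_comp _ _ h0); exact: Bnorm_continuous.
    exact: cvgM.
  - apply: cvgMr; apply: cvgD; rewrite expr2; under eq_fun do rewrite expr2.
      by apply: cvgM; exact: cvg_norm.
    by apply: cvgM; exact: cvg_norm.
exists (x, y) => z; apply: (le_trans (doubling_leS z)).
apply/ler_addgt0Pr => e e0; rewrite -lerBlDr.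
apply: (@closed_cvg _ _ F _ doubling (fun t => S - e <= t) (@closed_ge _ _) _ _ Fxy).
by apply: filterS (FS e e0) => w /= /ltW.
Qed.

End maximum.

(** * Comparison *)

Section controls_facts.
Context {R : realType} {s : R}.
Hypothesis s_ge0 : 0 <= s.

Lemma controls_neq0 (Lambda : set R) : Lambda !=set0 -> controls s Lambda !=set0.
Proof.
move=> [l0 Ll0].
have cL : (cst l0 : measurableTypeR R -> R) \in Lfun (leb s) 2%:E.
  by apply: (@Lfun2_bounded _ _ _ `|l0|).
exists (toL2 s (cst l0)); apply: (aeS (toL2E cL)) => r -> //.
Qed.

Lemma controls_norm (Lambda : set R) : compact Lambda ->
  exists2 N, 0 <= N & forall al : L2 s, controls s Lambda al -> `|al| <= N.
Proof.
move=> /compact_bounded[N [_ NL]].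
pose N' := `|N| + 1; have N'0 : 0 <= N' by rewrite addr_ge0.
exists (N' * Num.sqrt s); first by rewrite mulr_ge0// sqrtr_ge0.
move=> al aL; apply: norm_bounded => //; apply: (aeS aL) => r; apply: NL.
by rewrite /N'; have := ler_norm N; lra.
Qed.

End controls_facts.

(** The lower bound m is needed because the infimum of a set of reals that is not
    bounded below is a default value. *)
Lemma inf_le_add (R : realType) (I : Type) (f1 f2 : I -> R) (i0 : I) (m K : R) :
  (forall i, m <= f1 i) -> (forall i, f1 i <= f2 i + K) ->
  inf [set f1 i | i in [set: I]] <= inf [set f2 i | i in [set: I]] + K.
Proof.
move=> mf f12; rewrite -lerBlDr; apply: lb_le_inf.
  by exists (f2 i0), i0.
move=> _ [i _ <-]; rewrite lerBlDr; apply: le_trans (f12 i).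
by apply: ge_inf; [exists m => _ [j _ <-]|exists i].
Qed.

Section comparison.
Context (R : realType) (s beta rho mu lam CL : R) (Gamma Lambda : set R)
  (L : L2 s * controls s Lambda * Gamma -> R).
Hypotheses (s_gt0 : 0 < s) (beta_gt0 : 0 < beta) (rho_gt0 : 0 < rho) (lam_gt0 : 0 < lam).
Hypotheses (Gamma_compact : compact Gamma) (Gamma_neq0 : Gamma !=set0)
  (Lambda_neq0 : Lambda !=set0).
Hypotheses (CL_ge0 : 0 <= CL)
  (L_Blipschitz : forall x y alpha a,
     `|L (x, alpha, a) - L (y, alpha, a)| <= CL * Bnorm beta lam (x - y))
  (L_bounded : forall c, `|L c| <= CL).
Variables (N : R).
Hypotheses (N_ge0 : 0 <= N) (alphaN : forall al : L2 s, controls s Lambda al -> `|al| <= N).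
Local Notation "`[ x ]_B" := (Bnorm beta lam x) (at level 0, x at level 99).

(** The terms in p are the same on both sides, including its trace at 0; only the
    radial terms and the dependence of [L] on the state are left. *)
Lemma hamiltonian_sub (x y p : L2 s) (d : R) : 0 <= d -> domAstar p ->
  inf [set beta * delta0 p * set_val c.2 + dot (p + d *: x) (set_val c.1)
           + L (x, c.1, c.2) | c in [set: controls s Lambda * Gamma]] <=
  inf [set - beta * delta0 (- p) * set_val c.2 - dot (- p + d *: y) (set_val c.1)
           + L (y, c.1, c.2) | c in [set: controls s Lambda * Gamma]]
  + (d * (`|x| + `|y|) * N + CL * `[x - y]_B).
Proof.
move=> d0 pA.
have [al0 Lal0] := @controls_neq0 R s Lambda Lambda_neq0.
have [a0 Ga0] := Gamma_neq0.
pose c0 : controls s Lambda * Gamma := (exist _ al0 (mem_set Lal0), exist _ a0 (mem_set Ga0)).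
have [G [_ GP]] := compact_bounded Gamma_compact.
have GaP (a : Gamma) : `|set_val a| <= `|G| + 1.
  apply: GP; last exact: set_valP.
  by have := ler_norm G; lra.
have alP (al : controls s Lambda) : `|set_val al| <= N by apply: alphaN; exact: set_valP.
apply: (inf_le_add c0 (m := - (`|beta * delta0 p| * (`|G| + 1) + `|p + d *: x| * N + CL))).
  move=> c; rewrite -lerN2 opprK.
  rewrite (le_trans (ler_norm _))// normrN.
  rewrite (le_trans (ler_normD _ _))// lerD// (le_trans (ler_normD _ _))// lerD//.
    by rewrite normrM ler_wpM2l.
  by rewrite (le_trans (normr_dot _ _))// ler_wpM2l.
move=> c; rewrite delta0N// !dotDl dotNl !dotZl.
have h1 := L_Blipschitz x y c.1 c.2.
have h2 : `|dot x (set_val c.1)| <= `|x| * N.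
  by rewrite (le_trans (normr_dot _ _))// ler_wpM2l.
have h3 : `|dot y (set_val c.1)| <= `|y| * N.
  by rewrite (le_trans (normr_dot _ _))// ler_wpM2l.
have {}h2 : d * dot x (set_val c.1) <= d * (`|x| * N).
  by rewrite ler_wpM2l// (le_trans (ler_norm _)).
have {}h3 : d * dot y (set_val c.1) <= d * (`|y| * N).
  by rewrite ler_wpM2l// (le_trans (ler_norm _)).
move: h1 h2 h3; move: (dot x _) (dot y _) (dot p _) (L _) (L _) (`|x|) (`|y|).
move=> dx dy dp l1 l2 nx ny; move: (Bnorm _ _ _) (delta0 p) => b dl.
rewrite ler_norml => /andP[_ ?] ? ?; lra.
Qed.

(** The difference of the two viscosity inequalities at a maximum point. The term
    with the adjoint of A has a sign; everything else is small. *)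
Lemma doubling_estimate (u v : L2 s -> R) (a d : R) (x y : L2 s) :
  subsolution beta rho mu lam L u -> supersolution beta rho mu lam L v ->
  0 < a -> 0 < d ->
  (forall z, doubling beta lam u v a d z <= doubling beta lam u v a d (x, y)) ->
  rho * (u x - v y) <= `|mu| * (a * `[x - y]_B ^+ 2)
    + `|mu| * (d * (`|x| ^+ 2 + `|y| ^+ 2))
    + d * (`|x| + `|y|) * N + CL * `[x - y]_B
    + d * beta * set_norm Gamma ^+ 2.
Proof.
move=> [_ su] [_ sv] a0 d0 zmax.
pose p : L2 s := a *: opB beta lam (x - y).
have pA : domAstar p by apply: domAstarZ => //; exact: opB_domAstar.
have tx := test1_penalty s_gt0 beta_gt0 lam_gt0 y a0.
have ty := test1_penalty s_gt0 beta_gt0 lam_gt0 x a0.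
have gx : grad (penalty beta lam a y) x = p by exact: grad_penalty.
have gy : grad (penalty beta lam a x) y = - p.
  by rewrite grad_penalty// -opprB -scaleN1r opBZ// scaleN1r scalerN.
have t2 := @test2_sqnorm R s d d0.
have := su _ _ _ x tx t2; have := sv _ _ _ y ty t2.
rewrite gx gy (grad_sqnorm d0) /scalel !(radial_quotient_sqprofile _ (normr_ge0 _)).
move=> Hv Hu.
have {}Hu := Hu _; have {}Hv := Hv _.
have lmax : local_max (fun z => u z - (penalty beta lam a y z + sqnorm d z)) x.
  apply: (@filterS _ (nbhs x) (nbhs_filter x) setT _ _ filterT) => x' _.
  rewrite !penaltyE// !sqnormE//; have := zmax (x', y); rewrite /doubling /=.
  move: (Bnorm _ _ _ ^+ 2) (Bnorm _ _ _ ^+ 2) => b b'; lra.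
have lmin : local_min (fun z => v z + (penalty beta lam a x z + sqnorm d z)) y.
  apply: (@filterS _ (nbhs y) (nbhs_filter y) setT _ _ filterT) => y' _.
  rewrite !penaltyE// !sqnormE//; have := zmax (x, y'); rewrite /doubling /=.
  rewrite (Bnorm_sub s_gt0 beta_gt0 lam_gt0 y') (Bnorm_sub s_gt0 beta_gt0 lam_gt0 y x).
  move: (Bnorm _ _ _ ^+ 2) (Bnorm _ _ _ ^+ 2) => b b'; lra.
have {}Hu := Hu lmax; have {}Hv := Hv lmin.
have h := hamiltonian_sub x y (ltW d0) pA.
move: Hu Hv h; move: (inf _) (inf _) => i1 i2.
have pB : dot p (x - y) = a * `[x - y]_B ^+ 2 by rewrite dotZl Bnorm_sqr.
have pA0 : dot (opAstar beta p) (x - y) <= 0.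
  rewrite opAstarZ//; last exact: opB_domAstar.
  rewrite dotZl pmulr_rle0//; exact: dot_opAstar_opB.
have pN : opAstar beta (- p) = - opAstar beta p.
  by rewrite -scaleN1r opAstarZ// scaleN1r.
rewrite pN; move: (opAstar beta p) pA0 pB => Ap; clearbody p; rewrite !dotBr => pA0 pB.
rewrite !(dotDl, dotNl, dotZl) !dotZr !dotxx; move: pB pA0.
have : 0 <= a * `[x - y]_B ^+ 2 by rewrite mulr_ge0 ?sqr_ge0 ?(ltW a0).
have : 0 <= d * (`|x| ^+ 2 + `|y| ^+ 2) by rewrite mulr_ge0 ?addr_ge0 ?sqr_ge0 ?(ltW d0).
move: (dot Ap x) (dot Ap y) (dot p x) (dot p y) => ax ay px py.
move: (a * `[x - y]_B ^+ 2) => q; move: (Bnorm beta lam (x - y)) (`|x|) (`|y|).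
move=> b nx ny n0 q0 e1 e2 hu hv h.
have m1 := ler_norm mu; have m2 := ler_norm (- mu); rewrite normrN in m2.
have k1 : - mu * q <= `|mu| * q by rewrite ler_wpM2r.
have k2 : - mu * (d * (nx ^+ 2 + ny ^+ 2)) <= `|mu| * (d * (nx ^+ 2 + ny ^+ 2)).
  by rewrite ler_wpM2r.
have k3 : - mu * (px - py) = - mu * q by rewrite e1.
lra.
Qed.

(** If u exceeds v by D0 somewhere, the estimate at a maximum point bounds
    rho D0 by P / a + Q eta, where eta dominates the radial terms. The Lipschitz
    bounds make the penalization of order 1 / a; the radial parameter d is chosen last,
    from a near-maximizer of the functional without radial terms. *)
Theorem comparison_principle (u v : L2 s -> R) :
  subsolution beta rho mu lam L u -> supersolution beta rho mu lam L v ->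
  forall x, u x <= v x.
Proof.
move=> su sv x0; rewrite leNgt; apply/negP => uv0.
have [[cu [Mu uMu] [Cu uCu]] _] := su; have [[cv [Mv vMv] [Cv vCv]] _] := sv.
have B0 := Bnorm_ge0 s_gt0 beta_gt0 lam_gt0.
pose M := Num.max Mu Mv; pose C := Num.max 0 (Num.max Cu Cv).
have uM x : `|u x| <= M by rewrite (le_trans (uMu x))// le_max lexx.
have vM x : `|v x| <= M by rewrite (le_trans (vMv x))// le_max lexx orbT.
have C0 : 0 <= C by rewrite le_max lexx.
have uC x y : `|u x - u y| <= C * `[x - y]_B.
  by rewrite (le_trans (uCu x y))// ler_wpM2r// !le_max lexx !orbT.
have vC x y : `|v x - v y| <= C * `[x - y]_B.
  by rewrite (le_trans (vCv x y))// ler_wpM2r// !le_max lexx !orbT.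
pose D0 := u x0 - v x0; have D00 : 0 < D0 by rewrite subr_gt0.
have g0 : 0 <= beta * set_norm Gamma ^+ 2 by rewrite mulr_ge0 ?sqr_ge0 ?(ltW beta_gt0).
set g := beta * _ in g0.
(* [a] and [eta] are chosen so that each of the two errors is a quarter of rho D0. *)
pose P := 4 * `|mu| * C ^+ 2 + 2 * C * CL + 1.
pose Q := 4 * `|mu| + 3 * N + g + 2 * rho.
have P0 : 0 < P.
  by rewrite ltr_wpDl// addr_ge0// ?mulr_ge0// sqr_ge0.
have Q0 : 0 < Q by rewrite ltr_wpDl ?mulr_gt0// !addr_ge0// mulr_ge0.
pose a := 4 * P / (rho * D0); pose eta := rho * D0 / (4 * Q).
have a0 : 0 < a by rewrite divr_gt0 ?mulr_gt0.
have eta0 : 0 < eta by rewrite divr_gt0 ?mulr_gt0.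
have Pa : P / a = rho * D0 / 4 by rewrite /a; field; rewrite !gt_eqF.
have Qe : Q * eta = rho * D0 / 4 by rewrite /eta; field; rewrite !gt_eqF.
(* The supremum of [W] does not depend on [d], which can thus be taken small with
   respect to a near-maximizer of [W]; this bounds the radial terms at the maximum. *)
pose W (z : L2 s * L2 s) := u z.1 - v z.2 - a / 2 * `[z.1 - z.2]_B ^+ 2.
have WB z : W z <= 2 * M.
  have := uM z.1; have := vM z.2.
  have : 0 <= a * `[z.1 - z.2]_B ^+ 2 by rewrite mulr_ge0 ?sqr_ge0 ?(ltW a0).
  rewrite /W !ler_norml => ? /andP[? ?] /andP[? ?]; lra.
have hsW : has_sup (range W).
  by split; [exists (W (x0, x0)), (x0, x0)|exists (2 * M) => _ [z _ <-]].
have WS z : W z <= sup (range W) by apply: sup_upper_bound => //; exists z.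
have [_ [[x1 y1] _ <-] Wx1] := sup_adherent eta0 hsW.
pose n1 := `|x1| ^+ 2 + `|y1| ^+ 2.
have n10 : 0 <= n1 by rewrite addr_ge0 ?sqr_ge0.
pose d := eta / (1 + n1).
have d0 : 0 < d by rewrite divr_gt0// ltr_pwDl.
have dn1 : d * (1 + n1) = eta by rewrite divfK// gt_eqF// ltr_pwDl.
have dle : d <= eta by have := mulr_ge0 (ltW d0) n10; lra.
have dn1' : d * n1 <= eta by lra.
have doublingE z : doubling beta lam u v a d z = W z - d / 2 * (`|z.1| ^+ 2 + `|z.2| ^+ 2).
  by [].
have [[x y] zmax] := doubling_max s_gt0 beta_gt0 lam_gt0 uM vM uC vC cu cv C0 a0 d0.
have est := doubling_estimate su sv a0 d0 zmax.
have z1 := zmax (x1, y1); rewrite !doublingE /= -/n1 in z1.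
have Wxy := WS (x, y); have Wx0 := WS (x0, x0).
set n := `|x| ^+ 2 + `|y| ^+ 2 in z1 est.
have n0 : 0 <= n by rewrite addr_ge0 ?sqr_ge0.
have dn : d * n <= 4 * eta by lra.
set b := `[x - y]_B in est; have b0 : 0 <= b by exact: B0.
have W0 : D0 <= W (x0, x0).
  by rewrite /W /= subrr Bnorm0// expr0n mulr0 subr0.
have Wuv : W (x, y) <= u x - v y.
  rewrite /W/= gerBl; apply: mulr_ge0; last exact: sqr_ge0.
  by rewrite divr_ge0// (ltW a0).
have dn0 : 0 <= d * n by rewrite mulr_ge0// ltW.
have gap : D0 - 2 * eta <= u x - v y by lra.
(* Sum of the inequalities with the diagonal points (x, x) and (y, y). *)
have ab : a * b ^+ 2 <= 2 * C * b.
  have zx := zmax (x, x); have zy := zmax (y, y).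
  rewrite /doubling /= subrr Bnorm0// expr0n/= mulr0 subr0 in zx.
  rewrite /doubling /= subrr Bnorm0// expr0n/= mulr0 subr0 in zy.
  have ux : u x - u y <= C * b by rewrite (le_trans (ler_norm _)).
  have vx : v x - v y <= C * b by rewrite (le_trans (ler_norm _)).
  move: zx zy ux vx; rewrite -/b; clear; move: (`|x| ^+ 2) (`|y| ^+ 2) => nx ny.
  lra.
have ba : a * b <= 2 * C.
  have [b00|bn0] := eqVneq b 0; first by rewrite b00 mulr0 mulr_ge0.
  have bp : 0 < b by rewrite lt_neqAle eq_sym bn0.
  by rewrite -(ler_pM2r bp) -mulrA -expr2.
have ba' : b <= 2 * C / a by rewrite ler_pdivlMr// mulrC.
have e1 : CL * b <= CL * (2 * C / a) by rewrite ler_wpM2l.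
have e2 : `|mu| * (a * b ^+ 2) <= `|mu| * (2 * C * (2 * C / a)).
  by rewrite ler_wpM2l// (le_trans ab)// ler_wpM2l// mulr_ge0.
have e3 : `|mu| * (d * n) <= `|mu| * (4 * eta) by rewrite ler_wpM2l.
have e4 : d * (`|x| + `|y|) * N <= 3 * eta * N.
  rewrite ler_wpM2r//.
  have sx := sqr_ge0 (`|x| - 1); have sy := sqr_ge0 (`|y| - 1).
  have nl : `|x| + `|y| <= 1 + n / 2 by rewrite /n; rewrite !sqrrB in sx sy; lra.
  by apply: (@le_trans _ _ (d * (1 + n / 2))); [rewrite ler_pM2l|lra].
have e5 : d * beta * set_norm Gamma ^+ 2 <= eta * g.
  by rewrite -mulrA -/g ler_wpM2r.
have e6 : rho * (D0 - 2 * eta) <= rho * (u x - v y) by rewrite ler_pM2l.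
have Pa' : `|mu| * (2 * C * (2 * C / a)) + CL * (2 * C / a) + a^-1 = P / a.
  by rewrite /P; field; rewrite gt_eqF.
have Qe' : Q * eta = `|mu| * (4 * eta) + 3 * eta * N + eta * g + 2 * rho * eta.
  by rewrite /Q; ring.
have ai : 0 < a^-1 by rewrite invr_gt0.
have rD : 0 < rho * D0 by rewrite mulr_gt0.
lra.
Qed.

End comparison.

Theorem theorem3p7 (R : realType) (s beta rho mu lam CL : R)
  (Gamma Lambda : set R) (L : L2 s * controls s Lambda * Gamma -> R)
  (s_gt0 : 0 < s) (beta_gt0 : 0 < beta) (rho_gt0 : 0 < rho)
  (lam_gt0 : 0 < lam) (lam_lt1 : lam < 1)
  (Gamma_compact : compact Gamma) (Gamma_neq0 : Gamma !=set0)
  (Lambda_compact : compact Lambda) (Lambda_neq0 : Lambda !=set0)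
  (L_unif_continuous : unif_continuous L)
  (CL_ge0 : 0 <= CL)
  (L_Blipschitz : forall x y alpha a,
     `|L (x, alpha, a) - L (y, alpha, a)| <= CL * Bnorm beta lam (x - y))
  (L_bounded : forall c, `|L c| <= CL) :
  (forall u v : L2 s -> R,
     subsolution beta rho mu lam L u -> supersolution beta rho mu lam L v ->
     forall x, u x <= v x) /\
  (forall u1 u2 : L2 s -> R,
     solution beta rho mu lam L u1 -> solution beta rho mu lam L u2 -> u1 = u2).
Proof.
have [N N0 NP] := @controls_norm R s (ltW s_gt0) Lambda Lambda_compact.
have cmp u v : subsolution beta rho mu lam L u -> supersolution beta rho mu lam L v ->
    forall x, u x <= v x.
  exact: (comparison_principle s_gt0 beta_gt0 rho_gt0 lam_gt0 Gamma_compact Gamma_neq0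
    Lambda_neq0 CL_ge0 L_Blipschitz L_bounded N0 NP).
split=> [|u1 u2 [sub1 sup1] [sub2 sup2]]; first exact: cmp.
by apply/funext => x; apply/le_anti; rewrite !cmp.
Qed.
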